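(* Let $X$ be a set, $\Omega$ a nonempty set disjoint from $X$, and $\lambda_\Omega=(\lambda_\omega)_{\omega\in\Omega}$ a family of elements of $\mathbf{k}$. The set $\mathrm{Irr}(S)=\mathfrak{X}_\infty$ modulo $\mathrm{Id}(S)$ is a $\mathbf{k}$-linear basis of the free matching Rota-Baxter algebra $\mathbf{k}\mathfrak{M}(X,\Omega)/\mathrm{Id}(S)$ of weight $\lambda_\Omega$ on $X$.
   Context: $\mathbf{k}$ is a fixed unitary commutative ring; algebras are unitary associative $\mathbf{k}$-algebras. A matching Rota-Baxter algebra of weight $\lambda_\Omega$ is an algebra $R$ with linear operators $P_\omega:R\to R$, $\omega\in\Omega$, such that $P_\alpha(x)P_\beta(y)=P_\alpha(xP_\beta(y))+P_\beta(P_\alpha(x)y)+\lambda_\beta P_\alpha(xy)$ for all $x,y\in R$, $\alpha,\beta\in\Omega$; homomorphisms are algebra homomorphisms commuting with the operators, and free objects on a set are defined by the usual universal property. Bracketed words: for a set $Y$ and $\omega\in\Omega$, $\lfloor Y\rfloor_\omega=\{\lfloor y\rfloor_\omega\mid y\in Y\}$ is a copy of $Y$, disjoint from $Y$ and from the copies for other $\omega$. With $M(\cdot)$ (resp. $S(\cdot)$) the free monoid (resp. free semigroup), $\mathfrak{M}_0:=M(X)$, $\mathfrak{M}_{n+1}:=M\big(X\sqcup\bigsqcup_{\omega}\lfloor\mathfrak{M}_n\rfloor_\omega\big)$, $\mathfrak{M}(X,\Omega):=\bigcup_n\mathfrak{M}_n$, $P_\omega(u):=\lfloor u\rfloor_\omega$.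 The depth $\mathrm{dep}(u)$ is the least $n$ with $u\in\mathfrak{M}_n$. $S:=\{\lfloor x\rfloor_\alpha\lfloor y\rfloor_\beta-\lfloor x\lfloor y\rfloor_\beta\rfloor_\alpha-\lfloor\lfloor x\rfloor_\alpha y\rfloor_\beta-\lambda_\beta\lfloor xy\rfloor_\alpha\mid x,y\in\mathfrak{M}(X,\Omega),\alpha,\beta\in\Omega\}$, and $\mathrm{Id}(S)$ is the operated ideal of $\mathbf{k}\mathfrak{M}(X,\Omega)$ generated by $S$ (the smallest ideal containing $S$ and closed under all $P_\omega$). $\mathrm{Irr}(S):=\mathfrak{M}(X,\Omega)\setminus\{q|_{\bar s}\mid q\in\mathfrak{M}(X,\Omega)^\star,\ s\in S\}$, where $\mathfrak{M}(X,\Omega)^\star$ is the set of bracketed words on $X\sqcup\{\star\}$ ($\star\notin X$) with exactly one occurrence of $\star$, $q|_u$ is obtained by replacing $\star$ by $u$, and $\bar s$ is the largest bracketed word appearing in $s$ with respect to the monomial order $\leq_{\mathrm{db}}$ defined as follows. Fix well orders on $X$ and $\Omega$. On $M(X)$ use the degree lexicographical order. Every $u\in\mathfrak{M}(X,\Omega)$ is uniquely $u=u_0P_{\alpha_1}(u_1^* )u_1\cdots P_{\alpha_r}(u_r^* )u_r$ with $u_i\in M(X)$, $u_i^*\in\mathfrak{M}(X,\Omega)$, $\alpha_i\in\Omega$; put $\mathrm{bre}_P(u):=r$ and let $\deg_P(u)$ be the total number of brackets in $u$. For $v=v_0P_{\beta_1}(v_1^* )v_1\cdots P_{\beta_s}(v_s^*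 )v_s$, define $u\leq_{\mathrm{db}}v$ by induction on $\mathrm{dep}(u)+\mathrm{dep}(v)$: if it is $0$, use the order on $M(X)$; otherwise compare first $\deg_P$, then $\mathrm{bre}_P$, and if both are equal compare $(P_{\alpha_1},u_1^*,\ldots,P_{\alpha_r},u_r^*,u_0,\ldots,u_r)$ and $(P_{\beta_1},v_1^*,\ldots,P_{\beta_r},v_r^*,v_0,\ldots,v_r)$ lexicographically, the $P$'s by the order on $\Omega$ and the other entries by induction. $\mathfrak{X}_\infty$ (matching Rota-Baxter words): write $UV=\{uv\mid u\in U,v\in V\}$, $U^r$ for $r$-fold products ($U^0=\{1\}$), $\lfloor U\rfloor_\Omega=\{\lfloor u\rfloor_\omega\mid u\in U,\omega\in\Omega\}$. For $Y,Z\subseteq\mathfrak{M}(X,\Omega)$ set $$\Lambda(Y,Z):=\Big(\bigcup_{r\ge1}(Y\lfloor Z\rfloor_\Omega)^r\Big)\cup\Big(\bigcup_{r\ge0}(Y\lfloor Z\rfloor_\Omega)^rY\Big)\cup\Big(\bigcup_{r\ge1}(\lfloor Z\rfloor_\Omega Y)^r\Big)\cup\Big(\bigcup_{r\ge0}(\lfloor Z\rfloor_\Omega Y)^r\lfloor Z\rfloor_\Omega\Big)\cup\{1\}.$$ Then $\mathfrak{X}_0:=M(X)$, $\mathfrak{X}_n:=\Lambda(S(X),\mathfrak{X}_{n-1})$ for $n\ge1$, and $\mathfrak{X}_\infty:=\bigcup_{n\ge0}\mathfrak{X}_n$. *)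

(* Defs.v *)
From HB Require Import structures.
From mathcomp Require Import all_boot all_algebra.
From mathcomp Require Import finmap.
From mathcomp Require Import boolp classical_sets wochoice.
From mathcomp Require Export monalg.

Set Implicit Arguments.
Unset Strict Implicit.
Unset Printing Implicit Defensive.

Import GRing.Theory.

Local Open Scope ring_scope.
Local Open Scope quotient_scope.
Local Open Scope classical_set_scope.

(* A bracketed word is a finite sequence of letters, a letter being either a
   generator or a bracket around a bracketed word; the inductive type is the
   union of the stages M_n (see [stage] below). *)
Inductive letter (X Omega : Type) : Type :=
  | Gen of X
  | Brk of Omega & seq (letter X Omega).

Arguments Gen {X Omega}.
Arguments Brk {X Omega}.

Definition bword (X Omega : Type) : Type := seq (letter X Omega).

Section LetterChoice.
Variables X Omega : choiceType.

Fixpoint letter_encode (l : letter X Omega) : GenTree.tree (X + Omega) :=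
  match l with
  | Gen x => GenTree.Leaf (inl x)
  | Brk w u => GenTree.Node 0 (GenTree.Leaf (inr w) :: map letter_encode u)
  end.

Fixpoint letter_decode (t : GenTree.tree (X + Omega)) :
    option (letter X Omega) :=
  match t with
  | GenTree.Leaf (inl x) => Some (Gen x)
  | GenTree.Node _ (GenTree.Leaf (inr w) :: ts) =>
      Some (Brk w (pmap letter_decode ts))
  | _ => None
  end.

Fixpoint letter_encodeK (l : letter X Omega) :
  letter_decode (letter_encode l) = Some l.
Proof.
case: l => [x|w u] //=; congr (Some (Brk w _)).
by elim: u => //= l u IHu; rewrite letter_encodeK /= IHu.
Qed.

HB.instance Definition _ := Choice.copy (letter X Omega)
  (pcan_type letter_encodeK).
HB.instance Definition _ := Choice.on (bword X Omega).

Fact bword_cat_eq0 (u v : bword X Omega) :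
  u ++ v = [::] -> u = [::] /\ v = [::].
Proof. by case: u => //=; case: v. Qed.

HB.instance Definition _ := Choice_isMonomialDef.Build (bword X Omega)
  (@catA _) (@cat0s _) (@cats0 _) bword_cat_eq0.

End LetterChoice.

Section Words.
Variables X Omega : Type.
Implicit Types (u v : bword X Omega) (w : Omega).

Definition gen (x : X) : bword X Omega := [:: Gen x].

Definition brk w u : bword X Omega := [:: Brk w u].

Definition is_gen (l : letter X Omega) : bool :=
  if l is Gen _ then true else false.

Definition free_monoid : set (bword X Omega) := [set u | all is_gen u].

Definition free_semigroup : set (bword X Omega) :=
  [set u | all is_gen u && (0 < size u)%N].

(* stage n u says that u belongs to M_n *)
Fixpoint stage (n : nat) u : bool :=
  all (fun l => match l, n with
                | Gen _, _ => true
                | Brk _ _, 0 => false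
                | Brk _ v, n'.+1 => stage n' v
                end) u.

Fixpoint ldep (l : letter X Omega) : nat :=
  if l is Brk _ v then (foldr maxn 0 (map ldep v)).+1 else 0.

Definition dep u : nat := foldr maxn 0 (map ldep u).

Fixpoint ldegP (l : letter X Omega) : nat :=
  if l is Brk _ v then (sumn (map ldegP v)).+1 else 0.

Definition degP u : nat := sumn (map ldegP u).

(* decomp u = (u_0, [:: (alpha_1, u_1^*, u_1); ...; (alpha_r, u_r^*, u_r)])
   for u = u_0 P_(alpha_1)(u_1^* ) u_1 ... P_(alpha_r)(u_r^* ) u_r *)
Fixpoint decomp u : bword X Omega * seq (Omega * bword X Omega * bword X Omega) :=
  match u with
  | [::] => ([::], [::])
  | Gen x :: u' => let: (u0, s) := decomp u' in (Gen x :: u0, s)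
  | Brk w v :: u' => let: (u0, s) := decomp u' in ([::], (w, v, u0) :: s)
  end.

Definition breP u : nat := size (decomp u).2.

(* (P_(alpha_1), u_1^*, ..., P_(alpha_r), u_r^*, u_0, ..., u_r) *)
Definition profile u : seq (Omega + bword X Omega) :=
  let: (u0, s) := decomp u in
  flatten [seq [:: inl p.1.1; inr p.1.2] | p <- s]
    ++ inr u0 :: [seq inr p.2 | p <- s].

Definition gens u : seq X := pmap (fun l => if l is Gen x then Some x else None) u.

Lemma decompE u :
  u = (decomp u).1 ++ flatten [seq brk p.1.1 p.1.2 ++ p.2 | p <- (decomp u).2].
Proof. by elim: u => [|[x|w v] u /=] //; case: decomp => u0 s /= {1}->. Qed.

(* dep u is the least n such that u belongs to M_n *)
Lemma stage_dep n u : stage n u = (dep u <= n)%N.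
Proof.
elim: n u => [|n IHn] u; elim: u => [|[x|w v] u IHu] //=.
- by rewrite /dep /= max0n; exact: IHu.
- by rewrite leqn0 /dep /= maxnE addSn.
- by rewrite /dep /= max0n; exact: IHu.
- by rewrite /dep /= geq_max ltnS -/(dep v) -/(dep u) -IHn -IHu.
Qed.

End Words.

Fixpoint lexi (T : eqType) (le : rel T) (s t : seq T) : bool :=
  match s, t with
  | [::], _ => true
  | _ :: _, [::] => false
  | x :: s', y :: t' => if x == y then lexi le s' t' else le x y
  end.

Definition sum_le (S T : Type) (leS : rel S) (leT : rel T) : rel (S + T) :=
  fun a b => match a, b with
             | inl x, inl y => leS x y
             | inr x, inr y => leT x y
             | inl _, inr _ => true
             | inr _, inl _ => false
             end.

Section Order.
Variables (X Omega : choiceType) (leX : rel X) (leO : rel Omega).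
Implicit Types u v : bword X Omega.

(* Only meaningful on M(X): [gens] drops the brackets. *)
Definition deglex u v : bool :=
  if size u == size v then lexi leX (gens u) (gens v)
  else (size u < size v)%N.

Definition ledb_step (le : rel (bword X Omega)) u v : bool :=
  if (dep u + dep v == 0)%N then deglex u v
  else if degP u != degP v then (degP u < degP v)%N
  else if breP u != breP v then (breP u < breP v)%N
  else lexi (sum_le leO le) (profile u) (profile v).

Fixpoint ledb_rec (n : nat) : rel (bword X Omega) :=
  if n is n'.+1 then ledb_step (ledb_rec n') else deglex.

(* The recursion on dep u + dep v is bounded by fuel; [ledbE] is the
   defining equation of <=_db. *)
Definition ledb : rel (bword X Omega) := fun u v => ledb_rec (dep u + dep v) u v.

Lemma decomp_free_monoid u :
  free_monoid (decomp u).1 /\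
  forall p, p \in (decomp u).2 -> free_monoid p.2.
Proof.
elim: u => [|[x|w v] u IHu] /=; first by split.
  by case: decomp IHu => u0 s /= [gen_u0 gen_s]; split.
case: decomp IHu => u0 s /= [gen_u0 gen_s]; split=> // p.
by rewrite inE => /predU1P[-> //|]; exact: gen_s.
Qed.

Lemma profile_dep u v : inr v \in profile u -> (dep v <= (dep u).-1)%N.
Proof.
rewrite /profile; have := decomp_free_monoid u.
have gen0 (a : bword X Omega) : free_monoid a -> dep a = 0%N.
  by move=> ga; apply/eqP; rewrite -leqn0 -stage_dep.
case E: decomp => [u0 s] /= [/gen0 dep0 deps].
rewrite mem_cat inE => /or3P[|/eqP[->]|]; last 2 first.
- by rewrite dep0.
- move=> /mapP[[[w a] b] /= pin [->]]; rewrite (gen0 b) //.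
  exact: deps pin.
move=> /flatten_mapP[[[w a] b] /= pin]; rewrite !inE /= => /eqP[->] {v}.
have {E pin} : (w, a, b) \in (decomp u).2 by rewrite E.
suff: (w, a, b) \in (decomp u).2 -> (dep a < dep u)%N.
  by move=> /[apply]; case: (dep u).
elim: u {dep0 deps s u0} => [|[x|w' v'] u IHu] //=; case: decomp IHu => u0 s /= IHu.
  by move=> /IHu; rewrite /dep /= max0n.
rewrite /dep /= leq_max inE.
by case/predU1P=> [[_ <- _]|/IHu]; rewrite ?ltnSn // => ->; rewrite orbT.
Qed.

Lemma eq_lexi (T : eqType) (le1 le2 : rel T) s t :
  {in s & t, le1 =2 le2} -> lexi le1 s t = lexi le2 s t.
Proof.
elim: s t => [|x s IHs] [|y t] //= eq_le.
rewrite IHs ?eq_le ?mem_head // => a b a_s b_t.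
by apply: eq_le; rewrite inE ?a_s ?b_t orbT.
Qed.

Lemma ledb_stepW (le1 le2 : rel (bword X Omega)) u v :
  (forall a b, (dep a + dep b < dep u + dep v)%N -> le1 a b = le2 a b) ->
  ledb_step le1 u v = ledb_step le2 u v.
Proof.
move=> eq_le; rewrite /ledb_step; case: eqP => // /eqP uv_gt0.
rewrite (@eq_lexi _ (sum_le leO le1) (sum_le leO le2)) // => -[a|a] [b|b] //=.
move=> /profile_dep le_a /profile_dep le_b; apply: eq_le.
apply: leq_ltn_trans (leq_add le_a le_b) _.
by case: (dep u) (dep v) uv_gt0 => [|m] [|n] //= _; rewrite ?addSn ?addnS ltnS // leqW.
Qed.

Lemma ledbE u v : ledb u v = ledb_step ledb u v.
Proof.
suff recE n m a b : (dep a + dep b <= n)%N -> (dep a + dep b <= m)%N ->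
    ledb_rec n a b = ledb_rec m a b.
  rewrite -[ledb u v]/(ledb_rec _ u v) (recE _ (dep u + dep v).+1) //.
  by apply: ledb_stepW => a b lt_ab; apply: recE; rewrite // ltnW.
elim: n m a b => [|n IHn] [|m] a b //=.
- by rewrite leqn0 => /eqP ab0 _; rewrite /ledb_step ab0.
- by move=> _; rewrite leqn0 => /eqP ab0; rewrite /ledb_step ab0.
move=> le_n le_m; apply: ledb_stepW => c d lt_cd.
by apply: IHn; rewrite -ltnS; apply: leq_trans lt_cd _.
Qed.

End Order.

Section Star.
Variables X Omega : Type.

(* The extra generator star is None : option X *)
Fixpoint lstars (l : letter (option X) Omega) : nat :=
  match l with
  | Gen (Some _) => 0
  | Gen None => 1
  | Brk _ q => sumn (map lstars q)
  end.

Definition star_words : set (bword (option X) Omega) :=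
  [set q | sumn (map lstars q) = 1%N].

Fixpoint lsubst (u : bword X Omega) (l : letter (option X) Omega) :
    bword X Omega :=
  match l with
  | Gen (Some x) => gen Omega x
  | Gen None => u
  | Brk w q => brk w (flatten (map (lsubst u) q))
  end.

Definition subst_star (q : bword (option X) Omega) (u : bword X Omega) :
  bword X Omega := flatten (map (lsubst u) q).

End Star.

Section RBWords.
Variables X Omega : Type.
Implicit Types U V Y Z : set (bword X Omega).

Definition wmul U V : set (bword X Omega) := [set u ++ v | u in U & v in V].

Fixpoint wpow U (r : nat) : set (bword X Omega) :=
  if r is r'.+1 then wmul U (wpow U r') else [set [::]].

Definition wbrk Z : set (bword X Omega) :=
  [set brk w u | w in [set: Omega] & u in Z].

Definition Lambda Y Z : set (bword X Omega) :=
  \bigcup_(r in [set r | (1 <= r)%N]) wpow (wmul Y (wbrk Z)) r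
  `|` \bigcup_r wmul (wpow (wmul Y (wbrk Z)) r) Y
  `|` \bigcup_(r in [set r | (1 <= r)%N]) wpow (wmul (wbrk Z) Y) r
  `|` \bigcup_r wmul (wpow (wmul (wbrk Z) Y) r) (wbrk Z)
  `|` [set [::]].

Fixpoint rb_stage (n : nat) : set (bword X Omega) :=
  if n is n'.+1 then Lambda (@free_semigroup X Omega) (rb_stage n')
  else @free_monoid X Omega.

Definition rb_words : set (bword X Omega) := \bigcup_n rb_stage n.

End RBWords.

Arguments rb_words : clear implicits.

Section MatchingRB.
Variables (k : comNzRingType) (Omega : Type) (lam : Omega -> k).

Definition matching_rb (A : algType k) (P : Omega -> A -> A) : Prop :=
  (forall w, linear (P w)) /\
  forall (x y : A) (a b : Omega),
    P a x * P b y = P a (x * P b y) + P b (P a x * y) + lam b *: P a (x * y).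

Definition matching_rb_hom (A B : algType k) (P : Omega -> A -> A)
    (Q : Omega -> B -> B) (phi : {lrmorphism A -> B}) : Prop :=
  forall w a, phi (P w a) = Q w (phi a).

Definition free_matching_rb (X : Type) (F : algType k) (P : Omega -> F -> F)
    (i : X -> F) : Prop :=
  matching_rb P /\
  forall (A : algType k) (Q : Omega -> A -> A) (f : X -> A), matching_rb Q ->
  exists phi : {lrmorphism F -> A},
    [/\ matching_rb_hom P Q phi, forall x, phi (i x) = f x
      & forall psi : {lrmorphism F -> A},
          matching_rb_hom P Q psi -> (forall x, psi (i x) = f x) -> psi =1 phi].

End MatchingRB.

Definition is_basis (k : nzRingType) (V : lmodType k) (I : eqType) (A : set I)
    (e : I -> V) : Prop :=
  (forall (s : seq I) (c : I -> k), uniq s -> (forall i, i \in s -> A i) ->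
     \sum_(i <- s) c i *: e i = 0 -> forall i, i \in s -> c i = 0) /\
  (forall v : V, exists (s : seq I) (c : I -> k),
     (forall i, i \in s -> A i) /\ v = \sum_(i <- s) c i *: e i).

(* In a unital algebra, ideals are automatically closed under scaling. *)
Definition operated_ideal (R : nzRingType) (Omega : Type) (P : Omega -> R -> R)
    (I : set R) : Prop :=
  [/\ I 0, forall a b, I a -> I b -> I (a - b),
      forall a b, I b -> I (a * b) /\ I (b * a)
    & forall w a, I a -> I (P w a)].

Definition operated_ideal_gen (R : nzRingType) (Omega : Type)
    (P : Omega -> R -> R) (S : set R) : set R :=
  [set a | forall I, operated_ideal P I -> S `<=` I -> I a].

Section Operated.
Variables (k : comNzRingType) (X Omega : choiceType).
Local Notation kM := {malg k[bword X Omega]}.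

Definition of_word (u : bword X Omega) : kM := << (1 : k) *g u >>.

Definition bracket (w : Omega) (f : kM) : kM :=
  \sum_(u <- msupp f) << f@_u *g brk w u >>.

Lemma bracketEw w (d : {fset bword X Omega}) (f : kM) : (msupp f `<=` d)%fset ->
  bracket w f = \sum_(u <- d) << f@_u *g brk w u >>.
Proof.
move=> le; rewrite [LHS](big_fset_incl _ le) => //= x xd /mcoeff_outdom ->.
by rewrite monalgU0.
Qed.

Lemma bracket_word w u : bracket w (of_word u) = of_word (brk w u).
Proof. by rewrite /of_word (bracketEw _ msuppU_le) big_seq_fset1 mcoeffUU. Qed.

Fact bracket_is_linear w : linear (bracket w).
Proof.
move=> c f g; pose d := (msupp f `|` msupp g)%fset.
rewrite !(@bracketEw w d) ?fsubsetUl ?fsubsetUr //; last first.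
  apply: fsubset_trans (msuppD_le _ _) _.
  by rewrite fsetSU // msuppZ_le.
rewrite scaler_sumr -big_split /=; apply: eq_bigr => u _.
by apply/malgP => v; rewrite !mcoeffsE mulrnDl mulrnAr.
Qed.

HB.instance Definition _ w := GRing.isLinear.Build k kM kM *:%R (bracket w)
  (bracket_is_linear w).

Variable lam : Omega -> k.

Definition rb_rel (a b : Omega) (x y : bword X Omega) : kM :=
  of_word (brk a x ++ brk b y) - of_word (brk a (x ++ brk b y))
  - of_word (brk b (brk a x ++ y)) - lam b *: of_word (brk a (x ++ y)).

Definition rb_rels : set kM := [set s | exists a b x y, s = rb_rel a b x y].

Definition rb_ideal : set kM := operated_ideal_gen bracket rb_rels.

Lemma rb_ideal_operated : operated_ideal bracket rb_ideal.
Proof.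
split=> [I [] //|a b Ia Ib I idI SI|a b Ib|w a Ia I idI SI].
- by have [_ + _ _] := idI; apply; [apply: Ia|apply: Ib].
- by split=> I idI SI; have [_ _ /(_ a b) + _] := idI; case=> //; apply: Ib.
- by have [_ _ _ +] := idI; apply; apply: Ia.
Qed.

Lemma rb_ideal_proper : ~ rb_ideal 1.
Proof.
pose e : bword X Omega := [::].
have mcoeffM (f g : kM) : (f * g)@_e = f@_e * g@_e.
  exact: (@mcoeff1g_is_multiplicative (bword X Omega) k).1.
move=> I1; suff /eqP : (1 : kM)@_e = 0 by rewrite mcoeffU eqxx oner_eq0.
apply: (I1 [set a | a@_e = 0]) => [|_ [a [b [x [y ->]]]]] /=.
- split=> /= [|a b Ia Ib|a b Ib|w a Ia].
  + exact: mcoeff0.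
  + by rewrite mcoeffB Ia Ib subr0.
  + by rewrite !mcoeffM Ib mul0r mulr0.
  + by rewrite raddf_sum big1 // => u _ /=; rewrite mcoeffU mulr0n.
- have coef0 u : u != e -> (of_word u)@_e = 0.
    by move=> /negPf ue; rewrite /of_word mcoeffU ue.
  have coefB (c : k) (u v w z : bword X Omega) :
      u != e -> v != e -> w != e -> z != e ->
      (of_word u - of_word v - of_word w - c *: of_word z)@_e = 0.
    by move=> *; rewrite !mcoeffB mcoeffZ !coef0 // mulr0 !subr0.
  exact: coefB.
Qed.

(* The boolean form of Id(S) required by MathComp quotients *)
Definition rb_ideal_pred : {pred kM} := fun a => `[< rb_ideal a >].

Fact rb_ideal_zmod_closed : zmod_closed rb_ideal_pred.
Proof.
have [I0 IB _ _] := rb_ideal_operated.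
split=> [|a b /asboolP Ia /asboolP Ib]; apply/asboolP => //; exact: IB.
Qed.

HB.instance Definition _ := GRing.isZmodClosed.Build kM rb_ideal_pred
  rb_ideal_zmod_closed.

Definition rb_quot : Type := {ideal_quot rb_ideal_pred}.

HB.instance Definition _ := EqQuotient.on rb_quot.
HB.instance Definition _ := Choice.on rb_quot.
HB.instance Definition _ := ZmodQuotient.on rb_quot.

Local Notation Q := rb_quot.

Lemma eq_pi_rb (a b : kM) : \pi_Q a = \pi_Q b <-> rb_ideal (a - b).
Proof.
rewrite -[X in _ <-> X]asboolE -[asbool _]/(a - b \in rb_ideal_pred).
by rewrite Quotient.idealrBE; split=> /eqP.
Qed.

Definition rb_one : Q := \pi_Q 1.
Definition rb_mul (x y : Q) : Q := \pi_Q (repr x * repr y).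
Definition rb_scale (c : k) (x : Q) : Q := \pi_Q (c *: repr x).
Definition rb_op (w : Omega) (x : Q) : Q := \pi_Q (bracket w (repr x)).

Lemma rb_ideal_repr (a : kM) : rb_ideal (repr (\pi_Q a) - a).
Proof. by apply/eq_pi_rb; rewrite reprK. Qed.

Lemma rb_piM (a b : kM) : \pi_Q (a * b) = rb_mul (\pi_Q a) (\pi_Q b).
Proof.
have [_ IB IM _] := rb_ideal_operated; apply/esym/eq_pi_rb.
set a' := repr _; set b' := repr _.
have -> : a' * b' - a * b = a' * (b' - b) - (a - a') * b.
  by rewrite mulrBr mulrBl opprB addrA addrNK.
apply: (IB); first exact: (IM _ _ (rb_ideal_repr b)).1.
by apply: (IM _ _ _).2; rewrite -opprB -sub0r; apply: IB;
  [have [] := rb_ideal_operated|exact: rb_ideal_repr].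
Qed.

Lemma rb_piZ (c : k) (a : kM) : \pi_Q (c *: a) = rb_scale c (\pi_Q a).
Proof.
have [_ _ IM _] := rb_ideal_operated; apply/esym/eq_pi_rb.
by rewrite -scalerBr -mul_malgC; apply: (IM _ _ (rb_ideal_repr a)).1.
Qed.

Lemma rb_piP (w : Omega) (a : kM) : \pi_Q (bracket w a) = rb_op w (\pi_Q a).
Proof.
have [_ _ _ IP] := rb_ideal_operated; apply/esym/eq_pi_rb.
by rewrite -linearB; apply: IP; apply: rb_ideal_repr.
Qed.

Fact rb_mulA : associative rb_mul.
Proof.
elim/quotW=> x; elim/quotW=> y; elim/quotW=> z.
by rewrite -(rb_piM y z) -(rb_piM x y) -(rb_piM x) -(rb_piM _ z) mulrA.
Qed.

Fact rb_mul1 : left_id rb_one rb_mul.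
Proof. by elim/quotW=> x; rewrite -rb_piM mul1r. Qed.

Fact rb_mulr1 : right_id rb_one rb_mul.
Proof. by elim/quotW=> x; rewrite -rb_piM mulr1. Qed.

Fact rb_mulDl : left_distributive rb_mul +%R.
Proof.
elim/quotW=> x; elim/quotW=> y; elim/quotW=> z.
by rewrite -raddfD -(rb_piM x z) -(rb_piM y z) -(rb_piM _ z) -raddfD mulrDl.
Qed.

Fact rb_mulDr : right_distributive rb_mul +%R.
Proof.
elim/quotW=> x; elim/quotW=> y; elim/quotW=> z.
by rewrite -raddfD -(rb_piM x y) -(rb_piM x z) -(rb_piM x) -raddfD mulrDr.
Qed.

Fact rb_one_neq0 : rb_one != 0.
Proof.
apply/eqP; rewrite -[0](raddf0 \pi_Q) => /eq_pi_rb; rewrite subr0.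
exact: rb_ideal_proper.
Qed.

HB.instance Definition _ := GRing.Zmodule_isNzRing.Build Q
  rb_mulA rb_mul1 rb_mulr1 rb_mulDl rb_mulDr rb_one_neq0.

Fact rb_scaleA c d (x : Q) : rb_scale c (rb_scale d x) = rb_scale (c * d) x.
Proof. by elim/quotW: x => x; rewrite -(rb_piZ d) -(rb_piZ c) -(rb_piZ (c * d)) scalerA. Qed.

Fact rb_scale1 : left_id 1 rb_scale.
Proof. by elim/quotW=> x; rewrite -rb_piZ scale1r. Qed.

Fact rb_scaleDr : right_distributive rb_scale +%R.
Proof.
move=> c; elim/quotW=> x; elim/quotW=> y.
by rewrite -raddfD -(rb_piZ c x) -(rb_piZ c y) -(rb_piZ c) -raddfD scalerDr.
Qed.

Fact rb_scaleDl (x : Q) : {morph rb_scale^~ x : c d / c + d}.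
Proof. by elim/quotW: x => x c d; rewrite -(rb_piZ c) -(rb_piZ d) -(rb_piZ (c + d)) -raddfD scalerDl. Qed.

HB.instance Definition _ := GRing.Zmodule_isLmodule.Build k Q
  rb_scaleA rb_scale1 rb_scaleDr rb_scaleDl.

Fact rb_scaleAl (c : k) (x y : Q) : c *: (x * y) = (c *: x) * y.
Proof.
elim/quotW: x => x; elim/quotW: y => y.
change (rb_scale c (rb_mul (\pi_Q x) (\pi_Q y)) =
        rb_mul (rb_scale c (\pi_Q x)) (\pi_Q y)).
by rewrite -(rb_piM x y) -(rb_piZ c x) -(rb_piZ c) -(rb_piM (c *: x)) scalerAl.
Qed.

HB.instance Definition _ := GRing.Lmodule_isLalgebra.Build k Q rb_scaleAl.

Fact malg_scaleAr (c : k) (x y : kM) : c *: (x * y) = x * (c *: y).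
Proof.
have xC : x * c%:MP = c%:MP * x.
  rewrite mul_malgC malgM_def fgmulgU malgZ_def.
  by apply: eq_bigr => u _; rewrite mulm1 mulrC.
by rewrite -!mul_malgC !mulrA xC.
Qed.

Fact rb_scaleAr (c : k) (x y : Q) : c *: (x * y) = x * (c *: y).
Proof.
elim/quotW: x => x; elim/quotW: y => y.
change (rb_scale c (rb_mul (\pi_Q x) (\pi_Q y)) =
        rb_mul (\pi_Q x) (rb_scale c (\pi_Q y))).
by rewrite -(rb_piM x y) -(rb_piZ c y) -(rb_piZ c) -(rb_piM x) malg_scaleAr.
Qed.

HB.instance Definition _ := GRing.Lalgebra_isAlgebra.Build k Q rb_scaleAr.

(* u is the largest word of s for <=_db; a relation, as s = 0 has none *)
Definition is_leading (leX : rel X) (leO : rel Omega) (s : kM)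
    (u : bword X Omega) : Prop :=
  u \in msupp s /\ forall v, v \in msupp s -> ledb leX leO v u.

Definition irr (leX : rel X) (leO : rel Omega) : set (bword X Omega) :=
  ~` [set u | exists q s v, [/\ star_words q, rb_rels s, is_leading leX leO s v
                              & u = subst_star q v]].

End Operated.

Definition word_class (k : comNzRingType) (X Omega : choiceType)
    (lam : Omega -> k) (u : bword X Omega) : rb_quot X lam :=
  \pi_(rb_quot X lam) (of_word k u).

(* Main.v *)
From HB Require Import structures.
Require Import Defs.
From mathcomp Require Import all_boot all_algebra.
From mathcomp Require Import finmap zify.
From mathcomp Require Import boolp classical_sets wochoice.

(** The idea is to put a second product on the free module on bracketed words,
    for which the brackets already satisfy the matching Rota-Baxter identity,
    and to compare it with concatenation.

    The leading word of a relation is its only two-letter word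
    [a x][b y], so Irr(S) consists of the words in which no two brackets are
    adjacent, at any level ([irrP]); the alternating products in the definition
    of the matching Rota-Baxter words describe the same set ([rb_wordsP]).

    On all bracketed words, reduced or not, the product [dprod] is concatenation
    unless the two factors meet in brackets; these are then multiplied by
      [a p] . [b q] = [a (p . [b q])] + [b ([a p] . q)] + lam_b [a (p . q)],
    a recursion on the number of brackets. As only the letters at the junction
    are affected, associativity reduces to a product of three single brackets
    ([dprodA]), where it follows from the identity and seven smaller instances
    ([rb_op_assoc]). Thus concatenation is replaced by an associative product
    [dmul] for which the same brackets form a matching Rota-Baxter structure.

    Evaluating words with the new product gives a linear map [nf] which turns
    concatenation into [dmul] and commutes with brackets. Hence it kills Id(S)
    ([nf_ideal]), while it fixes reduced words ([wnf_reduced]): their classes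
    are linearly independent. Conversely the two products agree modulo Id(S), so
    [nf f] is congruent to [f] ([rb_class_nf]), and [nf f] only involves reduced
    words ([nf_reduced]): their classes span. This replaces a confluence
    argument on critical pairs.

    The universal property is the evaluation of bracketed words in a matching
    Rota-Baxter algebra, whose linear extension vanishes on Id(S)
    ([rb_quot_free]). *)

Set Implicit Arguments.
Unset Strict Implicit.
Unset Printing Implicit Defensive.

Import GRing.Theory.

(** * Reduced words *)

Section ReducedWords.
Variables X Omega : Type.
Implicit Types (u v : bword X Omega) (l m : letter X Omega).

(** Words are lists nested in [letter], so neither list induction nor induction
    on letters reaches the content of a bracket; viewing words as binary trees
    gives a hypothesis for the content of the first bracket and one for the rest
    of the word. *)
Lemma bword_ind (K : bword X Omega -> Prop) :
  K [::] -> (forall x u, K u -> K (Gen x :: u)) ->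
  (forall a v u, K v -> K u -> K (Brk a v :: u)) -> forall u, K u.
Proof.
move=> K0 Kgen Kbrk.
pose Kl l := if l is Brk _ v then K v else True.
have cons_K l u : Kl l -> K u -> K (l :: u).
  by case: l => [x _|a v Kv]; [apply: Kgen | apply: Kbrk].
suff Kall l : Kl l by elim=> // l u Ku; apply: cons_K.
by move: l; fix F 1 => -[x|a v] //=; elim: v => // l v Kv; apply: cons_K.
Qed.

(** Words without a first, respectively last, letter pass these tests, so that a
    factor which may be empty never blocks a concatenation. *)
Definition head_gen u : bool := if u is l :: _ then is_gen l else true.
Definition last_gen u : bool := if u is l :: u' then is_gen (last l u') else true.

Fixpoint lreduced l : bool :=
  if l is Brk _ v
  then all lreduced v && sorted (fun l m => is_gen l || is_gen m) v else true.

Definition reduced u : bool :=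
  all lreduced u && sorted (fun l m => is_gen l || is_gen m) u.

(** Only the letters at the junction can create a new adjacency. *)
Lemma reduced_cat u v :
  reduced (u ++ v) = [&& reduced u, reduced v & last_gen u || head_gen v].
Proof.
rewrite /reduced all_cat.
have -> : sorted (fun l m => is_gen l || is_gen m) (u ++ v) =
    [&& sorted (fun l m => is_gen l || is_gen m) u,
        sorted (fun l m => is_gen l || is_gen m) v & last_gen u || head_gen v].
  case: u => [|l u] /=; first by rewrite andbT.
  by rewrite cat_path; case: v => [|m v] /=; rewrite ?orbT ?andbT // [RHS]andbA andbAC andbA.
by do ![case: (all _ _) => //=]; rewrite ?andbF //= ?andbF.
Qed.

Lemma reduced_gen x u : reduced (Gen x :: u) = reduced u.
Proof. by rewrite -cat1s reduced_cat /= andbT. Qed.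

Lemma reduced_brk a v u :
  reduced (Brk a v :: u) = [&& reduced v, reduced u & head_gen u].
Proof. by rewrite -cat1s reduced_cat {1}/reduced /= !andbT. Qed.

Lemma last_gen_cat u v : v <> [::] -> last_gen (u ++ v) = last_gen v.
Proof. by case: u v => [|l u] [|m v] //= _; rewrite last_cat. Qed.

Lemma head_gen_cat u v : u <> [::] -> head_gen (u ++ v) = head_gen u.
Proof. by case: u. Qed.

Lemma degP_cat u v : degP (u ++ v) = (degP u + degP v)%N.
Proof. by rewrite /degP map_cat sumn_cat. Qed.

Lemma degP_brk a u : degP (brk a u) = (degP u).+1.
Proof. by rewrite /degP /= addn0. Qed.

End ReducedWords.

Section Occurrence.
Variables X Omega : Type.
Implicit Types (u v : bword X Omega) (q : bword (option X) Omega).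

Fixpoint lembed (l : letter X Omega) : letter (option X) Omega :=
  match l with
  | Gen x => Gen (Some x)
  | Brk a v => Brk a (map lembed v)
  end.

Definition embed u : bword (option X) Omega := map lembed u.
Definition stars q : nat := sumn (map (@lstars X Omega) q).

Lemma stars_embed u : stars (embed u) = 0%N.
Proof.
elim/bword_ind: u => [|x u IHu|a v u IHv IHu] //.
by rewrite /stars /= -![sumn _]/(stars (embed _)) IHv IHu.
Qed.

Lemma subst_star_cons l q v : subst_star (l :: q) v = lsubst v l ++ subst_star q v.
Proof. by []. Qed.

Lemma subst_embed u v : subst_star (embed u) v = u.
Proof.
elim/bword_ind: u => [|x u IHu|a w u IHw IHu] //=.
  by rewrite subst_star_cons /= IHu.
by rewrite subst_star_cons /= -/(subst_star _ _) IHw IHu.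
Qed.

(** A context with one hole singles out an occurrence of two adjacent brackets;
    the letters around it have to be read in the alphabet extended by the hole,
    hence [embed]. *)
Lemma not_reducedP u : ~~ reduced u <->
  exists q a b x y, star_words q /\ u = subst_star q (brk a x ++ brk b y).
Proof.
split.
  elim/bword_ind: u => [|x u IHu|a v u IHv IHu] //.
    rewrite reduced_gen => /IHu[q [a [b [y [z [q1 ->]]]]]].
    by exists (Gen (Some x) :: q), a, b, y, z.
  rewrite reduced_brk => /nandP[/IHv|/nandP[/IHu|]].
  - move=> [q [b [c [y [z [q1 ->]]]]]].
    exists (Brk a q :: embed u), b, c, y, z; split.
      by rewrite /star_words /= -[sumn (map _ (embed u))]/(stars _) stars_embed q1.
    by rewrite subst_star_cons subst_embed.
  - move=> [q [b [c [y [z [q1 ->]]]]]].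
    exists (Brk a (embed v) :: q), b, c, y, z; split.
      by rewrite /star_words /= -[sumn (map _ (embed v))]/(stars _) stars_embed.
    by rewrite subst_star_cons /= -/(subst_star _ _) subst_embed.
  case: u {IHu} => [|[x|b w] u] //= _.
  exists (Gen None :: embed u), a, b, v, w; split.
    by rewrite /star_words /= -[sumn _]/(stars _) stars_embed.
  by rewrite subst_star_cons subst_embed.
move=> [q [a [b [x [y [q1 ->]]]]]]; move: q1; rewrite /star_words /=.
elim/bword_ind: q => [|[z|] q IHq|c w q IHw IHq] //=.
- by rewrite add0n => /IHq; rewrite subst_star_cons reduced_gen.
- move=> [q0]; rewrite subst_star_cons /=.
  by rewrite reduced_brk !andbF.
rewrite subst_star_cons /= reduced_brk -/(subst_star w _).
case E: (sumn (map _ w)) => [|[|n]] //=.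
  by rewrite add0n => /IHq /negPf ->; rewrite andbF.
by move=> _; rewrite (negPf (IHw E)).
Qed.

End Occurrence.

(** * Matching Rota-Baxter words *)

Section RotaBaxterWords.
Variables X Omega : Type.
Local Open Scope classical_set_scope.
Implicit Types (u v : bword X Omega).
Local Notation word := (bword X Omega).
Local Notation Y := (@free_semigroup X Omega).

Lemma free_monoid_reduced u : free_monoid u -> [/\ reduced u, last_gen u & head_gen u].
Proof.
rewrite /free_monoid /=; elim: u => [|[x|a v] u IHu] //= /IHu[ru lu hu]; split=> //.
  by rewrite reduced_gen.
by case: u lu {ru hu IHu}.
Qed.

Lemma wpow_ind (U : set word) (K : word -> Prop) r u :
  K [::] -> (forall v w, U v -> K w -> K (v ++ w)) -> wpow U r u -> K u.
Proof.
move=> K0 KU; elim: r u => [u ->//|r IHr _ /= [v Uv [w /IHr Kw <-]]]; exact: KU.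
Qed.

(** In an alternating product the generators and the brackets separate each
    other; the induction on the exponent must also record what the first,
    respectively last, factor is. *)
Lemma rb_stage_reduced n u : rb_stage n u -> reduced u.
Proof.
elim: n u => [|n IHn] u /=; first by case/free_monoid_reduced.
have redY v : Y v -> [/\ reduced v, last_gen v, head_gen v & v <> [::]].
  move=> /andP[fv sv]; have [rv lv hv] := free_monoid_reduced fv.
  by split=> // v0; rewrite v0 in sv.
have redZ v : wbrk (rb_stage n) v -> reduced v.
  by move=> [a _ [w /IHn rw <-]]; rewrite /brk reduced_brk rw.
have redYZ r v : wpow (wmul Y (wbrk (rb_stage n))) r v -> reduced v && head_gen v.
  apply: (wpow_ind (K := fun v => reduced v && head_gen v)) => {v}// v w.
  move=> [y /redY[ry ly hy y0] [z /redZ rz <-]] /andP[rw hw].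
  rewrite !reduced_cat ry rz rw hw ly -catA head_gen_cat ?hy //=.
  by rewrite orbT.
have redZY r v : wpow (wmul (wbrk (rb_stage n)) Y) r v -> reduced v && last_gen v.
  apply: (wpow_ind (K := fun v => reduced v && last_gen v)) => {v}// v w.
  move=> [z /redZ rz [y /redY[ry ly hy y0] <-]] /andP[rw lw].
  rewrite !reduced_cat ry rz rw hy /= ?orbT last_gen_cat // ly /=.
  case: w lw {rw} => [|l w] lw; last by rewrite last_gen_cat.
  by rewrite cats0 last_gen_cat.
move=> [[[[[r _ /redYZ/andP[]//]|]|[r _ /redZY/andP[]//]]|]|->//].
- move=> [r _ [v /redYZ/andP[rv _] [y /redY[ry ly hy _] <-]]].
  by rewrite reduced_cat rv ry hy orbT.
- move=> [r _ [v /redZY/andP[rv lv] [z /redZ rz <-]]].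
  by rewrite reduced_cat rv rz lv.
Qed.

(** v(uv)^r = (vu)^r v: it converts the products that start with a generator
    into those that start with a bracket. *)
Lemma wpow_shift (U V : set word) r v u : wpow (wmul U V) r u -> V v ->
  wmul (wpow (wmul V U) r) V (v ++ u).
Proof.
elim: r u v => [|r IHr] u v /=.
  by move=> -> Vv; exists [::] => //; exists v; rewrite ?cats0.
move=> [_ [a Ua [b Vb <-]] [w rw <-]] Vv.
have [c rc [d Vd bw]] := IHr _ _ rw Vb.
exists ((v ++ a) ++ c); last by exists d => //; rewrite -!catA bw.
by exists (v ++ a); [exists v => //; exists a|exists c].
Qed.

Lemma wpowSr (U : set word) r u v : wpow U r u -> U v -> wpow U r.+1 (u ++ v).
Proof.
elim: r u => [|r IHr] u /=.
  by move=> -> Uv; exists v => //; exists [::]; rewrite ?cats0.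
move=> [a Ua [w rw <-]] Uv; exists a => //; exists (w ++ v); last by rewrite catA.
exact: IHr.
Qed.

(** Reading the word from the left, generators are collected in a block until a
    bracket closes it. *)
Lemma Lambda_nonadjacent (Z : set word) u :
  sorted (fun l m => is_gen l || is_gen m) u ->
  (forall a z, List.In (Brk a z) u -> Z z) -> Lambda Y Z u.
Proof.
pose G v := (exists r, wpow (wmul Y (wbrk Z)) r v) \/
            (exists r, wmul (wpow (wmul Y (wbrk Z)) r) Y v).
have G_brk y z v : Y y -> wbrk Z z -> G v -> G (y ++ z ++ v).
  move=> Yy Zz; have yz : wmul Y (wbrk Z) (y ++ z) by exists y => //; exists z.
  move=> [[r rv]|[r [w rw [y' Yy' <-]]]]; [left|right]; exists r.+1.
    by exists (y ++ z) => //; exists v; rewrite ?catA.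
  exists ((y ++ z) ++ w); last by exists y'; rewrite // !catA.
  by exists (y ++ z) => //; exists w.
(* the second part carries the block of generators under construction *)
have GP v : sorted (fun l m => is_gen l || is_gen m) v ->
    (forall a z, List.In (Brk a z) v -> Z z) ->
    (head_gen v -> G v) /\ forall y, Y y -> G (y ++ v).
  elim: v => [|l v IHv] sv Zv.
    split=> [_|y Yy]; first by left; exists 0%N.
    by right; exists 0%N, [::] => //; exists y; rewrite ?cats0.
  have {}IHv := IHv (path_sorted sv) (fun a z inz => Zv a z (or_intror inz)).
  case: l sv Zv => [x|a z] sv Zv /=.
    split=> [_|y Yy]; first by apply: (IHv.2 [:: Gen x]).
    rewrite -cat1s catA; apply: IHv.2; move: Yy; rewrite /free_semigroup /=.
    by rewrite all_cat size_cat /= => /andP[-> _]; rewrite addn1.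
  split=> // y Yy; apply: (G_brk y [:: Brk a z]) => //.
    by exists a => //; exists z => //; apply: (Zv a); left.
  by apply: IHv.1; case: v sv {IHv Zv} => //= l v /andP[].
move=> su Zu; have := GP u su Zu; case: u su Zu => [|[x|a z] u] su Zu [hG _].
- by right.
- case: (hG erefl) => [[[|r] ur]|[r ur]]; first by [].
    by left; left; left; left; exists r.+1.
  by left; left; left; right; exists r.
have Zz : wbrk Z [:: Brk a z] by exists a => //; exists z => //; apply: (Zu a); left.
have hu : head_gen u by case: u su {hG Zu} => //= l u /andP[].
have [+ _] := GP u (path_sorted su) (fun b y iny => Zu b y (or_intror iny)).
case/(_ hu) => [[r ur]|[r [w rw [y Yy <-]]]].
  by left; right; exists r => //; apply: (wpow_shift ur Zz).
left; left; right; exists r.+1 => //.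
have [c rc [d Zd e]] := wpow_shift rw Zz.
rewrite -cat1s catA -e -catA; apply: wpowSr => //.
by exists d => //; exists y.
Qed.

Lemma reduced_rb_stage n u : reduced u -> stage n u -> rb_stage n u.
Proof.
elim: n u => [|n IHn] u ru su.
  by move: su; rewrite /= /free_monoid /=; apply: sub_all => -[].
apply: Lambda_nonadjacent; first by case/andP: ru.
move=> a z inz; have [rz sz] : reduced z /\ stage n z.
  move: ru => /andP[+ _]; elim: u inz su => // l u IHu [->|inz] /andP[sl su] /andP[rl ru].
    by split; [exact: rl|exact: sl].
  exact: IHu.
exact: IHn.
Qed.

Lemma rb_wordsP u : rb_words X Omega u <-> reduced u.
Proof.
split=> [[n _ /rb_stage_reduced]|ru] //.
by exists (dep u) => //; apply: reduced_rb_stage => //; rewrite stage_dep.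
Qed.

End RotaBaxterWords.

(** * Leading words and irreducible words *)

Section Irreducible.
Local Open Scope ring_scope.
Variables (k : comNzRingType) (X Omega : choiceType) (lam : Omega -> k).
Variables (leX : rel X) (leO : rel Omega).
Local Notation word := (bword X Omega).

Lemma dep_brk a (u v : word) : (0 < dep (brk a u ++ v))%N.
Proof. by rewrite /dep /= leq_max. Qed.

Lemma ledb_degP_breP (u v : word) : (0 < dep v)%N ->
  (degP u < degP v)%N || (degP u == degP v) && (breP u < breP v)%N ->
  ledb leX leO u v && ~~ ledb leX leO v u.
Proof.
move=> v_gt0 lt_uv; rewrite !ledbE /ledb_step !addn_eq0 [dep v == 0%N]gtn_eqF //.
rewrite andbF /= [degP v == _]eq_sym [breP v == _]eq_sym.
case/orP: lt_uv => [lt_uv|/andP[-> lt_uv]]; rewrite ltn_eqF //= lt_uv -leqNgt;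
  exact: ltnW.
Qed.

Lemma ledb_refl_bracketed (u : word) : (0 < dep u)%N -> ledb leX leO u u.
Proof.
move=> u_gt0; rewrite ledbE /ledb_step addn_eq0 gtn_eqF //= !eqxx /=.
by elim: (profile u) => //= p s IHs; rewrite eqxx.
Qed.

(** The word of two brackets has at least as many brackets as the other words
    of the relation, which are single letters, so it wins on [degP] or on
    [breP]; its coefficient 1 cannot be cancelled. *)
Lemma rb_rel_lead (a b : Omega) (x y v : word) :
  is_leading leX leO (rb_rel lam a b x y) v <-> v = brk a x ++ brk b y.
Proof.
set L := brk a x ++ brk b y; set s := rb_rel lam a b x y.
have coefE w : s@_w = (L == w)%:R - (brk a (x ++ brk b y) == w)%:R
    - (brk b (brk a x ++ y) == w)%:R - lam b * (brk a (x ++ y) == w)%:R.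
  have combE (f g h e : {malg k[word]}) c f' g' h' e' :
      f@_w = f' -> g@_w = g' -> h@_w = h' -> e@_w = e' ->
      (f - g - h - c *: e)@_w = f' - g' - h' - c * e'.
    by move=> <- <- <- <-; rewrite !mcoeffB mcoeffZ.
  by apply: combE; apply: mcoeffU1.
have L_s : L \in msupp s.
  rewrite -mcoeff_neq0 coefE eqxx.
  have neqL c z : (brk c z == L) = false by apply/eqP => /(congr1 size).
  by rewrite !neqL mulr0 !subr0 oner_eq0.
have ltL w : w \in msupp s -> w != L -> ledb leX leO w L && ~~ ledb leX leO L w.
  move=> w_s w_L; apply: ledb_degP_breP; first exact: dep_brk.
  rewrite /L degP_cat !degP_brk.
  have [<-|n1] := eqVneq (brk a (x ++ brk b y)) w.
    by rewrite degP_brk degP_cat degP_brk addSn !addnS eqxx orbT.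
  have [<-|n2] := eqVneq (brk b (brk a x ++ y)) w.
    by rewrite degP_brk degP_cat degP_brk addSn !addnS eqxx orbT.
  have [<-|n3] := eqVneq (brk a (x ++ y)) w.
    by rewrite degP_brk degP_cat addSn !addnS ltnS leqnn.
  move: w_s; rewrite -mcoeff_neq0 coefE (negPf n1) (negPf n2) (negPf n3).
  by rewrite [L == w]eq_sym (negPf w_L) mulr0 !subr0 eqxx.
split=> [[v_s maxv]|->].
  by apply/eqP; apply: contraT => /(ltL _ v_s)/andP[_ /negP[]]; apply: maxv.
split=> // w w_s; have [->|/(ltL _ w_s)/andP[]//] := eqVneq w L.
exact/ledb_refl_bracketed/dep_brk.
Qed.

Lemma irrP (u : word) : irr lam leX leO u <-> reduced u.
Proof.
split=> [irru|ru].
  apply: contraT => /not_reducedP[q [a [b [x [y [q1 uE]]]]]]; case: irru.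
  exists q, (rb_rel lam a b x y), (brk a x ++ brk b y); split=> //.
    by exists a, b, x, y.
  exact/rb_rel_lead.
move=> [q [_ [v [q1 [a [b [x [y ->]]]] /rb_rel_lead -> uE]]]].
by have /not_reducedP/negP[] : exists q a b x y, star_words q /\
  u = subst_star q (brk a x ++ brk b y) by exists q, a, b, x, y.
Qed.

Lemma irr_rb_words : irr lam leX leO = rb_words X Omega.
Proof.
by apply/predeqP => u; apply: iff_trans (irrP u) (iff_sym (rb_wordsP u)).
Qed.

End Irreducible.

(** * Linear extension from words *)

Section LinearExtension.
Local Open Scope ring_scope.
Variables (k : comNzRingType) (X Omega : choiceType).
Local Notation word := (bword X Omega).
Local Notation kM := {malg k[word]}.
Local Notation W := (@of_word k X Omega).

Lemma of_word_mul (u v : word) : W u * W v = W (u ++ v).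
Proof. by rewrite malgM_def fgmulUU mulr1. Qed.

Lemma of_word_expand (f : kM) : f = \sum_(u <- msupp f) f@_u *: W u.
Proof.
rewrite [LHS]monalgE; apply: eq_bigr => u _.
by apply/malgP => v; rewrite mcoeffZ !mcoeffU mulr_natr.
Qed.

Lemma malg_word_ind (K : kM -> Prop) :
  K 0 -> (forall f g, K f -> K g -> K (f + g)) ->
  (forall c f, K f -> K (c *: f)) -> (forall u, K (W u)) -> forall f, K f.
Proof.
move=> K0 KD KZ KW f; rewrite (of_word_expand f).
by elim/big_ind: _ => // u _; apply: KZ.
Qed.

Lemma linear_0 (U V : lmodType k) (phi : U -> V) : linear phi -> phi 0 = 0.
Proof. by move=> /(_ (-1) 0 0); rewrite scaler0 addr0 scaleN1r addNr. Qed.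

Lemma linear_D (U V : lmodType k) (phi : U -> V) f g :
  linear phi -> phi (f + g) = phi f + phi g.
Proof. by move=> lphi; rewrite -[f]scale1r lphi !scale1r. Qed.

Lemma linear_Z (U V : lmodType k) (phi : U -> V) c f :
  linear phi -> phi (c *: f) = c *: phi f.
Proof. by move=> lphi; rewrite -[c *: f]addr0 lphi (linear_0 lphi) addr0. Qed.

(** Linearity is taken as a proposition, so that this applies to arbitrary
    expressions in [f] without declaring them as morphisms; the multilinear
    identities below are all reduced to words in this way. *)
Lemma eq_linear_word (V : lmodType k) (phi psi : kM -> V) :
  linear phi -> linear psi -> (forall u, phi (W u) = psi (W u)) ->
  forall f, phi f = psi f.
Proof.
move=> lphi lpsi eqW; elim/malg_word_ind => [|f g ef eg|c f ef|//].
- by rewrite !linear_0.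
- by rewrite !linear_D // ef eg.
- by rewrite !linear_Z // ef.
Qed.

Section Extend.
Variables (V : lmodType k) (F : word -> V).

Definition extend (f : kM) : V := \sum_(u <- msupp f) f@_u *: F u.

Lemma extendEw (d : {fset word}) (f : kM) : (msupp f `<=` d)%fset ->
  extend f = \sum_(u <- d) f@_u *: F u.
Proof.
move=> le; rewrite [LHS](big_fset_incl _ le) => //= x xd /mcoeff_outdom ->.
by rewrite scale0r.
Qed.

Fact extend_is_linear : linear extend.
Proof.
move=> c f g; pose d := (msupp f `|` msupp g)%fset.
rewrite !(@extendEw d) ?fsubsetUl ?fsubsetUr //; last first.
  apply: fsubset_trans (msuppD_le _ _) _.
  by rewrite fsetSU // msuppZ_le.
rewrite scaler_sumr -big_split /=; apply: eq_bigr => u _.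
by rewrite mcoeffD mcoeffZ scalerDl scalerA.
Qed.

HB.instance Definition _ := GRing.isLinear.Build k kM V *:%R extend
  extend_is_linear.

Lemma extend_word u : extend (W u) = F u.
Proof.
by rewrite (extendEw msuppU_le) big_seq_fset1 mcoeffUU scale1r.
Qed.

End Extend.

Lemma malgPl c (f g h : kM) : (c *: f + g) * h = c *: (f * h) + g * h.
Proof. by rewrite mulrDl scalerAl. Qed.

Lemma malgPr c (f g h : kM) : h * (c *: f + g) = c *: (h * f) + h * g.
Proof. by rewrite mulrDr malg_scaleAr. Qed.

Lemma bracketP a c (f g : kM) :
  bracket a (c *: f + g) = c *: bracket a f + bracket a g.
Proof. exact: bracket_is_linear. Qed.

Lemma rb_rel_image (lam : Omega -> k) (V : lmodType k) (phi : kM -> V)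
    (a b : Omega) (x y : word) f g h e :
  linear phi -> phi (W (brk a x ++ brk b y)) = f ->
  phi (W (brk a (x ++ brk b y))) = g -> phi (W (brk b (brk a x ++ y))) = h ->
  phi (W (brk a (x ++ y))) = e ->
  phi (rb_rel lam a b x y) = f - (g + h + lam b *: e).
Proof.
move=> lphi.
have phiB u v : phi (u - v) = phi u - phi v.
  by rewrite [u - v]addrC -[- v]scaleN1r lphi scaleN1r addrC.
have combE (s t u v : kM) c : phi s = f -> phi t = g -> phi u = h -> phi v = e ->
    phi (s - t - u - c *: v) = f - (g + h + c *: e).
  by move=> <- <- <- <-; rewrite !phiB (linear_Z _ _ lphi) !opprD !addrA.
exact: combE.
Qed.

End LinearExtension.

(** * The Rota-Baxter product on bracketed words *)

Section OperatorAssoc.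
Local Open Scope ring_scope.
Variables (k : comNzRingType) (Omega : Type) (lam : Omega -> k).
Variables (V : lmodType k) (m : V -> V -> V) (B : Omega -> V -> V).
Hypotheses (mDl : forall f g h, m (f + g) h = m f h + m g h)
  (mDr : forall f g h, m h (f + g) = m h f + m h g)
  (mZl : forall c f h, m (c *: f) h = c *: m f h)
  (mZr : forall c f h, m h (c *: f) = c *: m h f)
  (BD : forall a f g, B a (f + g) = B a f + B a g)
  (BZ : forall a c f, B a (c *: f) = c *: B a f)
  (mB : forall f g a b, m (B a f) (B b g) =
     B a (m f (B b g)) + B b (m (B a f) g) + lam b *: B a (m f g)).

Fact rb_terms_match (b c : k)
    (f x1 x2 x3 y y1 y2 y3 z1 z2 z3 z4 z5 : V) :
  f = x1 + x2 + c *: x3 -> y = y1 + y2 + b *: y3 ->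
  (f + y1 + c *: z1) + (z2 + y2 + c *: z3) + b *: (z4 + y3 + c *: z5) =
  (x1 + z2 + b *: z4) + (x2 + y + c *: z1) + c *: (x3 + z3 + b *: z5).
Proof.
move=> -> ->; rewrite !scalerDr !scalerA [c * b]mulrC !addrA.
by rewrite [LHS](ACl (1*6*9*2*4*7*10*5*3*8*11)).
Qed.

(** Expand both sides by [mB]. The product of f with B b g and B c h occurs under
    B a whole on the left and in three pieces on the right; the product of
    B a f and B b g with h occurs under B c in three pieces on the left and whole
    on the right. The first and fourth instances match these, and the other
    terms agree one by one by the remaining five instances. *)
Lemma rb_op_assoc (f g h : V) a b c :
  let assoc x y z := m (m x y) z = m x (m y z) in
  assoc f (B b g) (B c h) -> assoc (B a f) g (B c h) -> assoc f g (B c h) ->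
  assoc (B a f) (B b g) h -> assoc f (B b g) h -> assoc (B a f) g h ->
  assoc f g h -> assoc (B a f) (B b g) (B c h).
Proof.
rewrite /= => A1 A2 A3 A4 A5 A6 A7.
rewrite !(mB, mDl, mDr, mZl, mZr) A2 A3 A5 A6 A7.
apply: rb_terms_match.
  by rewrite A1 mB !mDr mZr !BD BZ.
by rewrite -A4 mB !mDl mZl !BD BZ.
Qed.

End OperatorAssoc.

Section Product.
Local Open Scope ring_scope.
Variables (k : comNzRingType) (X Omega : choiceType) (lam : Omega -> k).
Local Notation word := (bword X Omega).
Local Notation kM := {malg k[word]}.
Local Notation W := (@of_word k X Omega).
Local Notation br := (@bracket k X Omega).

(** Every recursive call has fewer brackets in its two arguments together, so
    the fuel [degP u + degP v] suffices, and any larger one gives the same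
    result. *)
Fixpoint dprod_rec (n : nat) (u v : word) : kM :=
  if n is n'.+1 then
    match rev u, v with
    | Brk a p :: u', Brk b q :: v' =>
        W (rev u') *
        (br a (dprod_rec n' p (brk b q)) + br b (dprod_rec n' (brk a p) q)
         + lam b *: br a (dprod_rec n' p q)) *
        W v'
    | _, _ => W (u ++ v)
    end
  else W (u ++ v).

Definition dprod (u v : word) : kM := dprod_rec (degP u + degP v) u v.

Lemma dprod_rec_fuel n m u v :
  (degP u + degP v <= n)%N -> (degP u + degP v <= m)%N ->
  dprod_rec n u v = dprod_rec m u v.
Proof.
have rev_nil (w : word) l w' : rev w = l :: w' -> w = rcons (rev w') l.
  by move=> e; rewrite -[w]revK e rev_cons.
have degP_rcons (w : word) l : degP (rcons w l) = (degP w + ldegP l)%N.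
  by rewrite -cats1 degP_cat /degP /= addn0.
elim: n m u v => [|n IHn] [|m] u v; first by [].
- rewrite leqn0 addn_eq0 => /andP[/eqP u0 /eqP v0] _.
  rewrite /=; case E: (rev u) => [|[x|a p] u']; [by []|by []|].
  by move: (rev_nil _ _ _ E) u0 => ->; rewrite degP_rcons addnS.
- rewrite leqn0 addn_eq0 => _ /andP[/eqP u0 /eqP v0].
  rewrite /=; case E: (rev u) => [|[x|a p] u']; [by []|by []|].
  by move: (rev_nil _ _ _ E) u0 => ->; rewrite degP_rcons addnS.
rewrite /=; case E: (rev u) => [|[x|a p] u']; [by []|by []|].
move: (rev_nil _ _ _ E) => -> {u E}.
case: v => [|[y|b q] v']; [by []|by []|]; rewrite degP_rcons -cat1s degP_cat degP_brk /=.
rewrite -[sumn _]/(degP p) => ln lm.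
have e1 : dprod_rec n p (brk b q) = dprod_rec m p (brk b q).
  by apply: IHn; rewrite degP_brk; lia.
have e2 : dprod_rec n (brk a p) q = dprod_rec m (brk a p) q.
  by apply: IHn; rewrite degP_brk; lia.
have e3 : dprod_rec n p q = dprod_rec m p q by apply: IHn; lia.
by rewrite e1 e2 e3.
Qed.

Lemma dprod_fuel n u v : (degP u + degP v <= n)%N -> dprod u v = dprod_rec n u v.
Proof. by move=> le_n; apply: dprod_rec_fuel. Qed.

Lemma dprod_brk (u p q v : word) a b :
  dprod (u ++ brk a p) (brk b q ++ v) =
  W u * (br a (dprod p (brk b q)) + br b (dprod (brk a p) q)
         + lam b *: br a (dprod p q)) * W v.
Proof.
pose n := (degP u + degP p + degP (brk b q ++ v))%N.
rewrite (@dprod_fuel n.+1 (u ++ _)); last by rewrite degP_cat degP_brk /n; lia.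
rewrite (@dprod_fuel n p (brk b q)); last by rewrite /n degP_cat; lia.
rewrite (@dprod_fuel n (brk a p) q).
  rewrite (@dprod_fuel n p q); last by rewrite /n degP_cat degP_brk; lia.
  by rewrite /= rev_cat /= revK.
by rewrite /n degP_cat !degP_brk; lia.
Qed.

Lemma dprod_brk1 (p q : word) a b :
  dprod (brk a p) (brk b q) =
  br a (dprod p (brk b q)) + br b (dprod (brk a p) q) + lam b *: br a (dprod p q).
Proof. by rewrite (dprod_brk [::] p q [::]) mul1r mulr1. Qed.

Lemma dprod_cat (u v : word) : last_gen u || head_gen v -> dprod u v = W (u ++ v).
Proof.
rewrite /dprod; case: (_ + _)%N => //= n.
case/lastP: u => [|u l] //; rewrite rev_rcons; case: l => [x|a p] //.
by case: v => [|[y|b q] v] //=; case: u => //= l u; rewrite last_rcons.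
Qed.

Lemma dprodu0 u : dprod u [::] = W u.
Proof. by rewrite dprod_cat ?cats0 ?orbT. Qed.

Lemma dprod0u u : dprod [::] u = W u.
Proof. exact: dprod_cat. Qed.

(** With [dprod_catr]: letters away from the junction are inert. *)
Lemma dprod_catl (u0 u v : word) : u <> [::] -> dprod (u0 ++ u) v = W u0 * dprod u v.
Proof.
move=> u_n0; have [junc|] := boolP (last_gen u || head_gen v).
  by rewrite !dprod_cat ?last_gen_cat // of_word_mul catA.
case/lastP: u u_n0 => [|u l] // _; rewrite -cats1 last_gen_cat //.
case: l => // a p; case: v => [|[x|b q] v] // _.
by rewrite catA -[Brk b q :: v]cat1s !dprod_brk -of_word_mul !mulrA.
Qed.

Lemma dprod_catr (u v v0 : word) : v <> [::] -> dprod u (v ++ v0) = dprod u v * W v0.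
Proof.
move=> v_n0; have [junc|] := boolP (last_gen u || head_gen v).
  by rewrite !dprod_cat ?head_gen_cat // of_word_mul catA.
case/lastP: u => [|u l]; first by [].
rewrite -cats1 last_gen_cat //.
case: l => // a p; case: v v_n0 => [|[x|b q] v] // _ _.
by rewrite -[Brk b q :: v]cat1s -catA !dprod_brk -of_word_mul !mulrA.
Qed.

(** Locked, so that distinct products are not compared by unfolding their double
    sums. *)
Definition dmul (f g : kM) : kM :=
  locked (fun f g => extend (fun u => extend (dprod u) g) f) f g.

Lemma dmul_unlock f g : dmul f g = extend (fun u => extend (dprod u) g) f.
Proof. by rewrite /dmul -lock. Qed.

Lemma dmul_word u v : dmul (W u) (W v) = dprod u v.
Proof. by rewrite dmul_unlock !extend_word. Qed.

Lemma dmulDl f g h : dmul (f + g) h = dmul f h + dmul g h.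
Proof. by rewrite !dmul_unlock linearD. Qed.

Lemma dmulZl c f h : dmul (c *: f) h = c *: dmul f h.
Proof. by rewrite !dmul_unlock linearZ. Qed.

Lemma dmulDr f g h : dmul f (g + h) = dmul f g + dmul f h.
Proof.
rewrite !dmul_unlock /extend -big_split /=; apply: eq_bigr => u _.
by rewrite -scalerDr -!/(extend _ _) linearD.
Qed.

Lemma dmulZr c f h : dmul f (c *: h) = c *: dmul f h.
Proof.
rewrite !dmul_unlock [in RHS]/extend scaler_sumr; apply: eq_bigr => u _.
by rewrite scalerA mulrC -scalerA -!/(extend _ _) linearZ.
Qed.

Lemma dmul0l f : dmul 0 f = 0.
Proof. by rewrite -[X in dmul X _](scale0r (0 : kM)) dmulZl scale0r. Qed.

Lemma dmul0r f : dmul f 0 = 0.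
Proof. by rewrite -[X in dmul _ X](scale0r (0 : kM)) dmulZr scale0r. Qed.

Lemma dmulPl c f g h : dmul (c *: f + g) h = c *: dmul f h + dmul g h.
Proof. by rewrite dmulDl dmulZl. Qed.

Lemma dmulPr c f g h : dmul h (c *: f + g) = c *: dmul h f + dmul h g.
Proof. by rewrite dmulDr dmulZr. Qed.

Definition linE := (dmulPl, dmulPr, malgPl, malgPr, bracketP).

Lemma dmul1l f : dmul (W [::]) f = f.
Proof.
move: f; apply: eq_linear_word => [c f g|c f g|u]; rewrite ?linE //.
by rewrite dmul_word dprod0u.
Qed.

Lemma dmul1r f : dmul f (W [::]) = f.
Proof.
move: f; apply: eq_linear_word => [c f g|c f g|u]; rewrite ?linE //.
by rewrite dmul_word dprodu0.
Qed.

Lemma dmul_catl (u v : word) (f : kM) : v <> [::] ->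
  dmul (W (u ++ v)) f = W u * dmul (W v) f.
Proof.
move=> v_n0; move: f; apply: eq_linear_word => [c f g|c f g|w]; rewrite ?linE //.
by rewrite !dmul_word dprod_catl.
Qed.

Lemma dmul_catr (f : kM) (v w : word) : v <> [::] ->
  dmul f (W (v ++ w)) = dmul f (W v) * W w.
Proof.
move=> v_n0; move: f; apply: eq_linear_word => [c f g|c f g|u]; rewrite ?linE //.
by rewrite !dmul_word dprod_catr.
Qed.

Lemma dmul_mull (f : kM) (v w : word) : v <> [::] ->
  dmul (f * W v) (W w) = f * dprod v w.
Proof.
move=> v_n0; move: f; apply: eq_linear_word => [c f g|c f g|u]; rewrite ?linE //.
by rewrite of_word_mul dmul_word dprod_catl.
Qed.

Lemma dmul_mulr (f : kM) (u v : word) : v <> [::] ->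
  dmul (W u) (W v * f) = dprod u v * f.
Proof.
move=> v_n0; move: f; apply: eq_linear_word => [c f g|c f g|w]; rewrite ?linE //.
by rewrite of_word_mul dmul_word dprod_catr.
Qed.

Lemma dmul_genl (u : word) x (f : kM) :
  dmul (W (u ++ gen Omega x)) f = W (u ++ gen Omega x) * f.
Proof.
move: f; apply: eq_linear_word => [c f g|c f g|v]; rewrite ?linE //.
by rewrite dmul_word dprod_cat ?of_word_mul // last_gen_cat.
Qed.

Lemma dmul_genr (u : word) x (f : kM) :
  dmul f (W (gen Omega x ++ u)) = f * W (gen Omega x ++ u).
Proof.
move: f; apply: eq_linear_word => [c f g|c f g|v]; rewrite ?linE //.
by rewrite dmul_word dprod_cat ?of_word_mul // orbT.
Qed.

Fact rb_sum_linear (c d : k) (x x' y y' z z' : kM) :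
  c *: x + x' + (c *: y + y') + d *: (c *: z + z') =
  c *: (x + y + d *: z) + (x' + y' + d *: z').
Proof.
rewrite !scalerDr !scalerA [d * c]mulrC [RHS]addrACA; congr (_ + _).
by rewrite [RHS]addrACA.
Qed.

Lemma dmul_rb (f g : kM) a b :
  dmul (br a f) (br b g) =
  br a (dmul f (br b g)) + br b (dmul (br a f) g) + lam b *: br a (dmul f g).
Proof.
move: f; apply: eq_linear_word => [c f f'|c f f'|u]; rewrite ?linE //.
  exact: rb_sum_linear.
move: g; apply: eq_linear_word => [c g g'|c g g'|v]; rewrite ?linE //.
  exact: rb_sum_linear.
by rewrite !bracket_word !dmul_word dprod_brk1.
Qed.

Lemma dmul_brkl (u w : word) a (f : kM) :
  dmul (W u * br a f) (W w) = W u * dmul (br a f) (W w).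
Proof.
move: f; apply: eq_linear_word => [c f g|c f g|v]; rewrite ?linE //.
by rewrite bracket_word of_word_mul !dmul_word dprod_catl.
Qed.

Lemma dmul_brkr (u w : word) a (f : kM) :
  dmul (W u) (br a f * W w) = dmul (W u) (br a f) * W w.
Proof.
move: f; apply: eq_linear_word => [c f g|c f g|v]; rewrite ?linE //.
rewrite bracket_word (of_word_mul k (brk a v) w).
by rewrite [dmul _ _ in LHS]dmul_word [dmul _ _ in RHS]dmul_word dprod_catr.
Qed.

(** A product of two brackets is a combination of brackets; this is how the
    inertness of the letters away from the junction passes to iterated
    products. *)
Lemma eq_linear_dprod (phi psi : kM -> kM) (p q : word) a b :
  linear phi -> linear psi -> (forall c f, phi (br c f) = psi (br c f)) ->
  phi (dprod (brk a p) (brk b q)) = psi (dprod (brk a p) (brk b q)).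
Proof.
have sumE (F : kM -> kM) (c : k) x y z :
    linear F -> F (x + y + c *: z) = F x + F y + c *: F z.
  by move=> lF; rewrite !(linear_D _ _ lF) (linear_Z _ _ lF).
move=> lphi lpsi e; rewrite dprod_brk1 (sumE _ _ _ _ _ lphi) (sumE _ _ _ _ _ lpsi).
exact: (congr2 +%R (congr2 +%R (e _ _) (e _ _)) (congr1 ( *:%R _) (e _ _))).
Qed.

Lemma dmul_dprodl (u w p q : word) a b :
  dmul (W u * dprod (brk a p) (brk b q)) (W w) =
  W u * dmul (dprod (brk a p) (brk b q)) (W w).
Proof.
apply: (@eq_linear_dprod (fun f => dmul (W u * f) (W w))
  (fun f => W u * dmul f (W w))) => [c f g|c f g|c f]; rewrite ?linE //.
exact: dmul_brkl.
Qed.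

Lemma dmul_dprodr (u w p q : word) a b :
  dmul (W u) (dprod (brk a p) (brk b q) * W w) =
  dmul (W u) (dprod (brk a p) (brk b q)) * W w.
Proof.
apply: (@eq_linear_dprod (fun f => dmul (W u) (f * W w))
  (fun f => dmul (W u) f * W w)) => [c f g|c f g|c f]; rewrite ?linE //.
exact: dmul_brkr.
Qed.

Lemma dprod_brkA (p q r : word) a b c :
  dmul (dprod p (brk b q)) (W (brk c r)) = dmul (W p) (dprod (brk b q) (brk c r)) ->
  dmul (dprod (brk a p) q) (W (brk c r)) = dmul (W (brk a p)) (dprod q (brk c r)) ->
  dmul (dprod p q) (W (brk c r)) = dmul (W p) (dprod q (brk c r)) ->
  dmul (dprod (brk a p) (brk b q)) (W r) = dmul (W (brk a p)) (dprod (brk b q) r) ->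
  dmul (dprod p (brk b q)) (W r) = dmul (W p) (dprod (brk b q) r) ->
  dmul (dprod (brk a p) q) (W r) = dmul (W (brk a p)) (dprod q r) ->
  dmul (dprod p q) (W r) = dmul (W p) (dprod q r) ->
  dmul (dprod (brk a p) (brk b q)) (W (brk c r)) =
  dmul (W (brk a p)) (dprod (brk b q) (brk c r)).
Proof.
rewrite -!dmul_word -!bracket_word.
apply: (@rb_op_assoc k Omega lam kM dmul br).
- exact: dmulDl.
- by move=> f g h; apply: dmulDr.
- exact: dmulZl.
- by move=> d f h; apply: dmulZr.
- by move=> d f g; apply: linearD.
- by move=> d e f; apply: linearZ.
- exact: dmul_rb.
Qed.

(** If the middle factor has at least two letters, or is a generator, the two
    junctions do not interact. If it is a single bracket, the outer factors may
    be cut down to the letters next to it; a generator there makes its junction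
    a concatenation, and the case left, three single brackets, follows by
    induction on the total number of brackets. *)
Lemma dprodA (u v w : word) :
  dmul (dprod u v) (W w) = dmul (W u) (dprod v w).
Proof.
move: (ltnSn (degP u + degP v + degP w)).
move: {2}(degP u + _ + _)%N.+1 => n.
elim: n u v w => [|n IHn] u v w; first by [].
case: v => [|l [|m v]]; first by rewrite dprodu0 dprod0u.
- case: l => [x _|b q].
    rewrite (@dprod_cat u) ?orbT // (@dprod_cat _ w) //.
    by rewrite [LHS]dmul_genl [RHS]dmul_genr !of_word_mul catA.
  case/lastP: u => [_|u l]; first by rewrite dprod0u [RHS]dmul1l [LHS]dmul_word.
  rewrite -cats1; case: l => [x _|a p].
    rewrite (@dprod_cat (u ++ [:: Gen x])) ?last_gen_cat //.
    by rewrite [LHS]dmul_catl // [RHS]dmul_genl [dmul _ _]dmul_word.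
  case: w => [|[x|c r] w].
  + by rewrite dprodu0 [LHS]dmul1r [RHS]dmul_word.
  + rewrite (@dprod_cat _ (Gen x :: w)); last exact: orbT.
    rewrite -[Gen x :: w]cat1s [LHS]dmul_genr [RHS]dmul_catr; last by [].
    by rewrite [dmul _ _]dmul_word.
  rewrite -[Brk c r :: w]cat1s !degP_cat !degP_brk => le_n.
  have core : dmul (dprod (brk a p) (brk b q)) (W (brk c r)) =
              dmul (W (brk a p)) (dprod (brk b q) (brk c r)).
    by apply: dprod_brkA; apply: IHn; rewrite ?degP_brk; lia.
  rewrite dprod_catl; last by [].
  rewrite dprod_catr; last by [].
  rewrite [LHS]dmul_catr; last by [].
  rewrite [RHS]dmul_catl; last by [].
  by rewrite [in LHS]dmul_dprodl [in RHS]dmul_dprodr core mulrA.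
move=> _; rewrite -[l :: _]cat1s dprod_catr; last by [].
rewrite [LHS]dmul_mull; last by [].
rewrite dprod_catl; last by [].
by rewrite [RHS]dmul_mulr.
Qed.

Lemma dmulA f g h : dmul (dmul f g) h = dmul f (dmul g h).
Proof.
move: f; apply: eq_linear_word => [c f f'|c f f'|u]; rewrite ?linE //.
move: g; apply: eq_linear_word => [c g g'|c g g'|v]; rewrite ?linE //.
move: h; apply: eq_linear_word => [c h h'|c h h'|w]; rewrite ?linE //.
by rewrite !dmul_word dprodA.
Qed.

End Product.

(** * Normal forms *)

Section NormalForm.
Local Open Scope ring_scope.
Variables (k : comNzRingType) (X Omega : choiceType) (lam : Omega -> k).
Local Notation word := (bword X Omega).
Local Notation kM := {malg k[word]}.
Local Notation W := (@of_word k X Omega).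
Local Notation br := (@bracket k X Omega).
Local Notation dm := (dmul lam).

Fixpoint lnf (l : letter X Omega) : kM :=
  match l with
  | Gen x => W (gen Omega x)
  | Brk a v => br a (foldr (fun m f => dm (lnf m) f) (W [::]) v)
  end.

Definition wnf (u : word) : kM := foldr (fun m f => dm (lnf m) f) (W [::]) u.

Definition nf : kM -> kM := extend wnf.

Lemma wnf_cat u v : wnf (u ++ v) = dm (wnf u) (wnf v).
Proof.
elim: u => [|l u IHu]; first by rewrite dmul1l.
by rewrite [LHS]/= -/(wnf _) IHu -dmulA.
Qed.

Lemma wnf_brk a u : wnf (brk a u) = br a (wnf u).
Proof. exact: dmul1r. Qed.

Lemma nf_word u : nf (W u) = wnf u.
Proof. exact: extend_word. Qed.

Lemma nf_linear : linear nf.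
Proof. exact: extend_is_linear. Qed.

Lemma nfM f g : nf (f * g) = dm (nf f) (nf g).
Proof.
move: f; apply: eq_linear_word => [c f f'|c f f'|u].
- by rewrite malgPl nf_linear.
- by rewrite nf_linear dmulPl.
move: g; apply: eq_linear_word => [c g g'|c g g'|v].
- by rewrite malgPr nf_linear.
- by rewrite nf_linear dmulPr.
by rewrite of_word_mul !nf_word wnf_cat.
Qed.

Lemma nf_bracket a f : nf (br a f) = br a (nf f).
Proof.
move: f; apply: eq_linear_word => [c f g|c f g|u].
- by rewrite bracketP nf_linear.
- by rewrite nf_linear bracketP.
by rewrite bracket_word !nf_word wnf_brk.
Qed.

Lemma nfB f g : nf (f - g) = nf f - nf g.
Proof. exact: linearB. Qed.

Lemma nf_rb_rel a b x y : nf (rb_rel lam a b x y) = 0.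
Proof.
rewrite -(subrr (dm (br a (wnf x)) (br b (wnf y)))) [X in _ = _ - X]dmul_rb.
apply: rb_rel_image; first exact: nf_linear.
- rewrite [LHS]nf_word [LHS]wnf_cat.
  by rewrite [wnf (brk a x)]wnf_brk [wnf (brk b y)]wnf_brk.
- by rewrite [LHS]nf_word [LHS]wnf_brk wnf_cat wnf_brk.
- by rewrite [LHS]nf_word [LHS]wnf_brk wnf_cat wnf_brk.
- by rewrite [LHS]nf_word [LHS]wnf_brk wnf_cat.
Qed.

(** The kernel of a homomorphism of operated algebras is an operated ideal, and
    in the target the relations hold. *)
Lemma nf_ideal f : rb_ideal lam f -> nf f = 0.
Proof.
move=> If; apply: (If (fun g => nf g = 0)); last first.
  by move=> _ [a [b [x [y ->]]]]; apply: nf_rb_rel.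
split=> /= [|f0 g0 f00 g00|f0 g0 g00|a g0 g00].
- exact: linear0.
- by rewrite nfB f00 g00 subr0.
- by rewrite !nfM g00 dmul0l dmul0r.
- by rewrite nf_bracket g00 linear0.
Qed.

Lemma wnf_reduced u : reduced u -> wnf u = W u.
Proof.
elim/bword_ind: u => [|x u IHu|a v u IHv IHu] //.
  rewrite reduced_gen => /IHu wu; rewrite [LHS]/= -/(wnf u) wu dmul_word.
  exact: dprod_cat.
rewrite reduced_brk => /and3P[/IHv wv /IHu wu hu].
rewrite [LHS]/= -/(wnf u) -/(wnf v) wv wu bracket_word dmul_word.
by rewrite dprod_cat // hu orbT.
Qed.

Definition supported (K : word -> bool) (f : kM) : Prop :=
  forall u, u \in msupp f -> K u.

Lemma supportedD (K : word -> bool) f g :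
  supported K f -> supported K g -> supported K (f + g).
Proof.
by move=> Kf Kg u /(fsubsetP (msuppD_le _ _)); rewrite in_fsetU => /orP[/Kf|/Kg].
Qed.

Lemma supportedZ (K : word -> bool) c f : supported K f -> supported K (c *: f).
Proof. by move=> Kf u /(fsubsetP (msuppZ_le _ _))/Kf. Qed.

Lemma supported_word (K : word -> bool) u : K u -> supported K (W u).
Proof. by move=> Ku v; rewrite msuppU oner_eq0 inE => /eqP->. Qed.

Lemma supported_linear (K K' : word -> bool) (phi : kM -> kM) f : linear phi ->
  (forall u, K u -> supported K' (phi (W u))) -> supported K f -> supported K' (phi f).
Proof.
move=> lphi Kphi Kf.
rewrite [f]of_word_expand big_seq.
elim/big_ind: _ => [|g h Kg Kh|u uf].
- by rewrite linear_0 // => u; rewrite msupp0.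
- by rewrite linear_D //; apply: supportedD.
by rewrite linear_Z //; apply/supportedZ/Kphi/Kf.
Qed.

Lemma supported_bracket_reduced (u v : word) a f : reduced u -> reduced v ->
  last_gen u -> head_gen v ->
  supported (@reduced X Omega) f -> supported (@reduced X Omega) (W u * br a f * W v).
Proof.
move=> ru rv lu hv; apply: (@supported_linear _ _ (fun g => W u * br a g * W v)).
  by move=> c g h; rewrite bracketP malgPr malgPl.
move=> w rw; rewrite bracket_word !of_word_mul; apply: supported_word.
by rewrite !reduced_cat reduced_brk ru rv rw lu hv /= !orbT.
Qed.

(** Each bracket produced at the junction is one letter in place of two, and its
    neighbours, which stood next to a bracket before, are generators. *)
Lemma dprod_reduced u v : reduced u -> reduced v ->
  supported (@reduced X Omega) (dprod lam u v).
Proof.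
move: (ltnSn (degP u + degP v)); move: {2}(degP u + degP v)%N.+1 => n.
elim: n u v => [|n IHn] u v; first by [].
have [junc _ ru rv|] := boolP (last_gen u || head_gen v).
  by rewrite dprod_cat //; apply: supported_word; rewrite reduced_cat ru rv.
case/lastP: u => [|u l]; first by [].
rewrite -cats1 last_gen_cat //.
case: l => // a p; case: v => [|[x|b q] v] // _.
rewrite -[Brk b q :: v]cat1s !degP_cat !degP_brk => le_n.
rewrite !reduced_cat => /and3P[ru rp]; rewrite /= orbF => lu /and3P[rq rv hv].
have [rp' rq'] : reduced p /\ reduced q.
  by move: rp rq; rewrite !reduced_brk => /andP[-> _] /andP[-> _].
rewrite dprod_brk 2!mulrDr 2!mulrDl -malg_scaleAr -scalerAl.
apply: supportedD; first apply: supportedD; last apply: supportedZ.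
- by apply: supported_bracket_reduced => //; apply: IHn => //; rewrite degP_brk; lia.
- by apply: supported_bracket_reduced => //; apply: IHn => //; rewrite degP_brk; lia.
- by apply: supported_bracket_reduced => //; apply: IHn => //; lia.
Qed.

Lemma dmul_reduced f g : supported (@reduced X Omega) f ->
  supported (@reduced X Omega) g -> supported (@reduced X Omega) (dm f g).
Proof.
move=> rf rg; move: rf; apply: (@supported_linear _ _ (fun h => dm h g)) => [c h h'|u ru].
  exact: dmulPl.
move: rg; apply: (@supported_linear _ _ (fun h => dm (W u) h)) => [c h h'|v rv].
  exact: dmulPr.
by rewrite dmul_word; apply: dprod_reduced.
Qed.

Lemma nf_reduced f : supported (@reduced X Omega) (nf f).
Proof.
suff rW u : supported (@reduced X Omega) (wnf u).
  apply: (@supported_linear xpredT _ nf) => // [|u _]; first exact: nf_linear.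
  by rewrite nf_word.
elim/bword_ind: u => [|x u ru|a v u rv ru].
- exact: supported_word.
- by rewrite [wnf _]/= -/(wnf u); apply: dmul_reduced => //; apply: supported_word.
rewrite [wnf _]/= -/(wnf u) -/(wnf v); apply: dmul_reduced => //.
move: rv; apply: (@supported_linear _ _ (br a)) => [|w rw].
  exact: bracket_is_linear.
by rewrite bracket_word; apply: supported_word; rewrite reduced_brk rw.
Qed.

End NormalForm.

(** * The quotient and its universal property *)

Section Quotient.
Local Open Scope ring_scope.
Local Open Scope quotient_scope.
Variables (k : comNzRingType) (X Omega : choiceType) (lam : Omega -> k).
Local Notation word := (bword X Omega).
Local Notation kM := {malg k[word]}.
Local Notation W := (@of_word k X Omega).
Local Notation br := (@bracket k X Omega).
Local Notation Q := (rb_quot X lam).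

Definition rb_class (f : kM) : Q := \pi_Q f.

Lemma rb_class_ind (K : Q -> Prop) : (forall f, K (rb_class f)) -> forall x, K x.
Proof. by move=> KQ; elim/quotW. Qed.

Lemma rb_class_eq f g : rb_class f = rb_class g <-> rb_ideal lam (f - g).
Proof. exact: eq_pi_rb. Qed.

Lemma rb_classM f g : rb_class (f * g) = rb_class f * rb_class g.
Proof. exact: rb_piM. Qed.

Lemma rb_classZ c f : rb_class (c *: f) = c *: rb_class f.
Proof. exact: rb_piZ. Qed.

Lemma rb_classD f g : rb_class (f + g) = rb_class f + rb_class g.
Proof. exact: raddfD. Qed.

Lemma rb_class0 : rb_class 0 = 0.
Proof. exact: raddf0. Qed.

Lemma rb_class_bracket a f : rb_class (br a f) = rb_op a (rb_class f).
Proof. exact: rb_piP. Qed.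

Lemma rb_class_cat u v : rb_class (W (u ++ v)) = rb_class (W u) * rb_class (W v).
Proof. by rewrite -rb_classM of_word_mul. Qed.

Lemma rb_class_brk a u : rb_class (W (brk a u)) = rb_op a (rb_class (W u)).
Proof. by rewrite -rb_class_bracket bracket_word. Qed.

Lemma rb_class1 : rb_class (W [::]) = 1.
Proof. by []. Qed.

Lemma rb_class_linear : linear rb_class.
Proof. by move=> c f g; rewrite rb_classD rb_classZ. Qed.

Lemma rb_op_linear a : linear (@rb_op k X Omega lam a).
Proof.
move=> c; elim/rb_class_ind => f; elim/rb_class_ind => g.
by rewrite -!rb_class_bracket -rb_class_linear -rb_class_bracket bracketP rb_class_linear.
Qed.

Lemma rb_quot_matching : matching_rb lam (@rb_op k X Omega lam).
Proof.
split=> [a|x y a b]; first exact: rb_op_linear.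
elim/rb_class_ind: x => f; elim/rb_class_ind: y => g.
have termsE (d e : k) (x x' y y' z z' : Q) :
    d *: (x + y + e *: z) + (x' + y' + e *: z') =
    d *: x + x' + (d *: y + y') + e *: (d *: z + z').
  rewrite !scalerDr !scalerA [d * e]mulrC [LHS]addrACA; congr (_ + _).
  by rewrite addrACA.
move: f; apply: eq_linear_word => [c f f'|c f f'|u].
- by rewrite rb_class_linear rb_op_linear mulrDl -scalerAl.
- rewrite rb_class_linear rb_op_linear !mulrDl -!scalerAl !rb_op_linear.
  by rewrite termsE.
move: g; apply: eq_linear_word => [c g g'|c g g'|v].
- by rewrite rb_class_linear rb_op_linear mulrDr -scalerAr.
- rewrite rb_class_linear rb_op_linear !mulrDr -!scalerAr !rb_op_linear.
  by rewrite termsE.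
have rel0 : rb_class (rb_rel lam a b u v) = 0.
  by rewrite -rb_class0; apply/rb_class_eq; rewrite subr0 => I _; apply; exists a, b, u, v.
apply: subr0_eq; rewrite -[RHS]rel0; apply/esym/rb_rel_image.
- exact: rb_class_linear.
- exact: (etrans (rb_class_cat _ _) (congr2 *%R (rb_class_brk a u) (rb_class_brk b v))).
- exact: (etrans (rb_class_brk a _) (congr1 _ (etrans (rb_class_cat u _)
    (congr1 _ (rb_class_brk b v))))).
- exact: (etrans (rb_class_brk b _) (congr1 _ (etrans (rb_class_cat _ v)
    (congr1 ( *%R^~ _) (rb_class_brk a u))))).
- exact: (etrans (rb_class_brk a _) (congr1 _ (rb_class_cat u v))).
Qed.

(** In the quotient, the recursion defining [dprod] is the Rota-Baxter identity
    itself. *)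
Lemma rb_class_dprod u v : rb_class (dprod lam u v) = rb_class (W u) * rb_class (W v).
Proof.
move: (ltnSn (degP u + degP v)); move: {2}(degP u + degP v)%N.+1 => n.
elim: n u v => [|n IHn] u v; first by [].
have [junc _|] := boolP (last_gen u || head_gen v).
  by rewrite dprod_cat // rb_class_cat.
case/lastP: u => [|u l]; first by [].
rewrite -cats1 last_gen_cat //.
case: l => // a p; case: v => [|[x|b q] v] // _.
rewrite -[Brk b q :: v]cat1s !degP_cat !degP_brk => le_n.
have e1 := IHn p (brk b q); have e2 := IHn (brk a p) q; have e3 := IHn p q.
rewrite degP_brk in e1; rewrite degP_brk in e2.
have le1 : (degP p + (degP q).+1 < n)%N by lia.
have le2 : ((degP p).+1 + degP q < n)%N by lia.
have le3 : (degP p + degP q < n)%N by lia.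
move: {e1 e2 e3} (e1 le1) (e2 le2) (e3 le3) => e1 e2 e3.
have sumE (f g h : kM) (f' g' h' : Q) c :
    rb_class f = f' -> rb_class g = g' -> rb_class h = h' ->
    rb_class (f + g + c *: h) = f' + g' + c *: h'.
  by move=> <- <- <-; rewrite !rb_classD rb_classZ.
have bracketsE f g h (x y x' y' : Q) :
    rb_class f = x * y' -> rb_class g = x' * y -> rb_class h = x * y ->
    x' = rb_op a x -> y' = rb_op b y ->
    rb_class (br a f + br b g + lam b *: br a h) = x' * y'.
  move=> fE gE hE x'E y'E.
  have e := sumE _ _ _ _ _ _ (lam b) (rb_class_bracket a f)
    (rb_class_bracket b g) (rb_class_bracket a h).
  rewrite [LHS]e fE gE hE x'E y'E; exact/esym/rb_quot_matching.2.
have sandwichE (x y d u' v' p' q' : Q) :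
    d = p' * q' -> x = u' * p' -> y = q' * v' -> u' * d * v' = x * y.
  by move=> -> -> ->; rewrite !mulrA.
rewrite dprod_brk 2!rb_classM.
apply: sandwichE (rb_class_cat u (brk a p)) (rb_class_cat (brk b q) v).
exact: bracketsE e1 e2 e3 (rb_class_brk a p) (rb_class_brk b q).
Qed.

Lemma rb_class_dmul f g : rb_class (dmul lam f g) = rb_class f * rb_class g.
Proof.
move: f; apply: eq_linear_word => [c f f'|c f f'|u].
- by rewrite dmulPl rb_class_linear.
- by rewrite rb_class_linear mulrDl -scalerAl.
move: g; apply: eq_linear_word => [c g g'|c g g'|v].
- by rewrite dmulPr rb_class_linear.
- by rewrite rb_class_linear mulrDr -scalerAr.
by rewrite dmul_word rb_class_dprod.
Qed.

Lemma rb_class_nf f : rb_class (nf lam f) = rb_class f.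
Proof.
move: f; apply: eq_linear_word => [c f g|c f g|u].
- by rewrite nf_linear rb_class_linear.
- exact: rb_class_linear.
rewrite nf_word; elim/bword_ind: u => [|x u IHu|a v u IHv IHu] //.
  by rewrite [wnf _ _]/= -/(wnf lam u) rb_class_dmul IHu -cat1s -of_word_mul rb_classM.
rewrite [wnf _ _]/= -/(wnf lam u) -/(wnf lam v) rb_class_dmul IHu.
by rewrite rb_class_bracket IHv -rb_class_bracket bracket_word -cat1s -of_word_mul rb_classM.
Qed.

(** [nf] is a linear retraction onto the span of the reduced words whose kernel
    is Id(S). *)
Lemma rb_class_reduced_basis (A : set word) : (forall u, A u <-> reduced u) ->
  is_basis A (@word_class k X Omega lam).
Proof.
move=> AE; split=> [s c uniq_s As sum0 i i_s|v].
  have classE : rb_class (\sum_(j <- s) c j *: W j) = rb_class 0.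
    rewrite rb_class0 -[RHS]sum0 [LHS]raddf_sum.
    by apply: eq_bigr => j _; apply: rb_classZ.
  move/rb_class_eq: classE; rewrite subr0 => /nf_ideal.
  rewrite [nf _ _]linear_sum (eq_big_seq (fun j => c j *: W j)) => [|j j_s].
    move=> /(congr1 (mcoeff i)); rewrite mcoeff0 raddf_sum (bigD1_seq i) //=.
    rewrite mcoeffZ mcoeffU1 eqxx mulr1 big1 ?addr0 // => j /negPf ji.
    by rewrite mcoeffZ mcoeffU1 ji mulr0.
  by rewrite [LHS]linearZ; congr (_ *: _); rewrite [LHS]nf_word wnf_reduced //; apply/AE/As.
elim/rb_class_ind: v => f; rewrite -rb_class_nf.
exists (msupp (nf lam f)), (fun u => (nf lam f)@_u); split=> [u /nf_reduced/AE//|].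
rewrite {1}[nf lam f]of_word_expand [LHS]raddf_sum.
by apply: eq_bigr => u _; apply: rb_classZ.
Qed.

Section Universal.
Variables (A : algType k) (P : Omega -> A -> A) (f : X -> A).
Hypothesis P_rb : matching_rb lam P.

Fixpoint leval (l : letter X Omega) : A :=
  match l with
  | Gen x => f x
  | Brk a v => P a (foldr (fun m z => leval m * z) 1 v)
  end.

Definition weval (u : word) : A := foldr (fun m z => leval m * z) 1 u.

Definition meval : kM -> A := extend weval.

Definition rb_eval (x : Q) : A := meval (repr x).

Lemma weval_cat u v : weval (u ++ v) = weval u * weval v.
Proof. by elim: u => [|l u IHu] /=; rewrite ?mul1r // -/(weval _) IHu mulrA. Qed.

Lemma weval_brk a u : weval (brk a u) = P a (weval u).
Proof. exact: mulr1. Qed.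

Lemma meval_word u : meval (W u) = weval u.
Proof. exact: extend_word. Qed.

Lemma meval_linear : linear meval.
Proof. exact: extend_is_linear. Qed.

Lemma mevalM g h : meval (g * h) = meval g * meval h.
Proof.
move: g; apply: eq_linear_word => [c g g'|c g g'|u].
- by rewrite malgPl meval_linear.
- by rewrite meval_linear mulrDl -scalerAl.
move: h; apply: eq_linear_word => [c h h'|c h h'|v].
- by rewrite malgPr meval_linear.
- by rewrite meval_linear mulrDr -scalerAr.
by rewrite of_word_mul !meval_word weval_cat.
Qed.

Lemma meval_bracket a g : meval (br a g) = P a (meval g).
Proof.
move: g; apply: eq_linear_word => [c g h|c g h|u].
- by rewrite bracketP meval_linear.
- by rewrite meval_linear P_rb.1.
by rewrite bracket_word !meval_word weval_brk.
Qed.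

Lemma mevalB g h : meval (g - h) = meval g - meval h.
Proof. exact: linearB. Qed.

Lemma meval_rb_rel a b x y : meval (rb_rel lam a b x y) = 0.
Proof.
rewrite -(subrr (P a (weval x) * P b (weval y))) [X in _ = _ - X]P_rb.2.
apply: rb_rel_image; first exact: meval_linear.
- rewrite [LHS]meval_word [LHS]weval_cat.
  by rewrite [weval (brk a x)]weval_brk [weval (brk b y)]weval_brk.
- by rewrite [LHS]meval_word [LHS]weval_brk weval_cat weval_brk.
- by rewrite [LHS]meval_word [LHS]weval_brk weval_cat weval_brk.
- by rewrite [LHS]meval_word [LHS]weval_brk weval_cat.
Qed.

Lemma meval_ideal g : rb_ideal lam g -> meval g = 0.
Proof.
move=> Ig; apply: (Ig (fun h => meval h = 0)); last first.
  by move=> _ [a [b [x [y ->]]]]; apply: meval_rb_rel.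
split=> /= [|g0 h0 g00 h00|g0 h0 h00|a h0 h00].
- exact: linear0.
- by rewrite mevalB g00 h00 subr0.
- by rewrite !mevalM h00 mulr0 mul0r.
- by rewrite meval_bracket h00 (linear_0 (P_rb.1 a)).
Qed.

Lemma rb_eval_class g : rb_eval (rb_class g) = meval g.
Proof.
apply: subr0_eq; rewrite -[LHS]mevalB.
apply: meval_ideal.
exact: rb_ideal_repr.
Qed.

Fact rb_eval_is_linear : linear rb_eval.
Proof.
move=> c; elim/rb_class_ind => g; elim/rb_class_ind => h.
by rewrite -rb_class_linear !rb_eval_class meval_linear.
Qed.

Fact rb_eval_is_monoid_morphism : monoid_morphism rb_eval.
Proof.
split; first by rewrite -rb_class1 rb_eval_class meval_word.
elim/rb_class_ind => g; elim/rb_class_ind => h.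
by rewrite -rb_classM !rb_eval_class mevalM.
Qed.

HB.instance Definition _ := GRing.isLinear.Build k Q A *:%R rb_eval rb_eval_is_linear.
HB.instance Definition _ :=
  GRing.isMonoidMorphism.Build Q A rb_eval rb_eval_is_monoid_morphism.

(** The morphism structure depends on [P_rb], hence this packaged version for
    use outside the section. *)
Definition rb_eval_hom : {lrmorphism Q -> A} := rb_eval.

Lemma rb_eval_op a x : rb_eval (rb_op a x) = P a (rb_eval x).
Proof.
elim/rb_class_ind: x => g.
by rewrite -rb_class_bracket !rb_eval_class meval_bracket.
Qed.

Lemma rb_eval_gen x : rb_eval (word_class lam (gen Omega x)) = f x.
Proof. by rewrite rb_eval_class meval_word; apply: mulr1. Qed.

Lemma rb_eval_unique (psi : {lrmorphism Q -> A}) :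
  matching_rb_hom (@rb_op k X Omega lam) P psi ->
  (forall x, psi (word_class lam (gen Omega x)) = f x) -> psi =1 rb_eval.
Proof.
move=> psi_op psi_gen; elim/rb_class_ind => g; rewrite rb_eval_class.
move: g; apply: eq_linear_word => [c g h|c g h|u].
- by rewrite rb_class_linear linearP.
- exact: meval_linear.
rewrite meval_word; elim/bword_ind: u => [|x u IHu|a v u IHv IHu].
- by rewrite rb_class1 rmorph1.
- rewrite -[Gen x :: u]cat1s [rb_class _]rb_class_cat [LHS]rmorphM.
  exact: (congr2 *%R (psi_gen x) IHu).
rewrite -[Brk a v :: u]cat1s [rb_class _]rb_class_cat [LHS]rmorphM.
rewrite [X in psi X * _](rb_class_brk a v) [X in X * _]psi_op.
exact: (congr2 (fun y z => P a y * z) IHv IHu).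
Qed.

End Universal.

Lemma rb_quot_free :
  free_matching_rb lam (@rb_op k X Omega lam)
    (fun x : X => word_class lam (gen Omega x)).
Proof.
split=> [|A P f P_rb]; first exact: rb_quot_matching.
exists (rb_eval_hom f P_rb); split.
- by move=> a x; apply: rb_eval_op P_rb a x.
- by move=> x; apply: rb_eval_gen P_rb x.
- by move=> psi; apply: rb_eval_unique.
Qed.

End Quotient.

Theorem theorem3p8 (k : comNzRingType) (X Omega : choiceType)
    (lam : Omega -> k) (Omega0 : inhabited Omega)
    (leX : rel X) (leO : rel Omega)
    (woX : well_order leX) (woO : well_order leO) :
  [/\ irr lam leX leO = rb_words X Omega,
      free_matching_rb lam (@rb_op k X Omega lam)
        (fun x : X => word_class lam (gen Omega x))
    & is_basis (irr lam leX leO) (@word_class k X Omega lam)].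
Proof.
split; first exact: irr_rb_words.
- exact: rb_quot_free.
- by apply: rb_class_reduced_basis => u; apply: irrP.
Qed.
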